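(* There is an approximation-preserving polynomial-time reduction from the rooted subset $k$-connectivity problem to the subset $k$-connectivity problem: given an instance consisting of a graph $G=(V,E)$ with nonnegative edge costs, a root $r\in V\setminus T$, a terminal set $T$ and the integer $k$, it outputs an instance of the subset $k$-connectivity problem (with the same $k$) consisting of a graph $G'$ with nonnegative edge costs and the terminal set $T\cup\{r'\}$, where $r'$ is a vertex of $G'$ corresponding to $r$, such that every feasible solution of either instance can be transformed in polynomial time into a feasible solution of the other instance of the same cost. In particular, the two instances have the same optimal cost and any $\beta$-approximation for the subset instance yields a $\beta$-approximation for the rooted instance.
   Context: Subset $k$-connectivity problem: given a finite undirected graph $G=(V,E)$ with nonnegative edge costs, a terminal set $T\subseteq V$ and an integer $k$, find a minimum-cost $\widehat E\subseteq E$ such that in $(V,\widehat E)$ every pair of distinct terminals is joined by $k$ openly disjoint paths (paths sharing no vertices other than their common endpoints). Rooted subset $k$-connectivity problem: given $G=(V,E)$ with nonnegative edge costs, a root $r\in V$, a terminal set $T\subseteq V$ and $k$, find a minimum-cost $\widehat E\subseteq E$ such that $(V,\widehat E)$ contains $k$ openly disjoint $r,t$-paths for every $t\in T$. *)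

(* Defs.v *)
From HB Require Import structures.
From mathcomp Require Import all_boot all_order all_algebra.

Set Implicit Arguments.
Unset Strict Implicit.
Unset Printing Implicit Defensive.

Import Order.TTheory GRing.Theory Num.Theory.

(** * Polynomial time

    The machine model is the WHILE language over binary trees of N. D. Jones,
    "Computability and Complexity from a Programming Perspective" (MIT Press,
    1997), extended with an equality test on trees.  Every access to a variable
    is charged the size of the tree stored in it, i.e. trees are copied and
    never shared.  Hence the total size of a store grows by at most the elapsed
    time, and the model and Turing machines simulate each other with polynomial
    overhead, also for the computation of functions. *)

Inductive tree := Leaf | Node of tree & tree.

Fixpoint tsize (t : tree) : nat :=
  if t is Node a b then (tsize a + tsize b).+1 else 1.

Fixpoint tree_eqb (t u : tree) : bool :=
  match t, u with
  | Leaf, Leaf => true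
  | Node a b, Node c d => tree_eqb a c && tree_eqb b d
  | _, _ => false
  end.

Inductive expr :=
  | Var of nat
  | ELeaf
  | ENode of expr & expr
  | Hd of expr
  | Tl of expr
  | EEq of expr & expr.

Inductive cmd :=
  | Skip
  | Assign of nat & expr
  | Seq of cmd & cmd
  | If of expr & cmd & cmd
  | While of expr & cmd.

Definition store := nat -> tree.

Definition update (s : store) (x : nat) (t : tree) : store :=
  fun y => if y == x then t else s y.

(* [Leaf] is false, every other tree is true *)
Definition istrue (t : tree) : bool := if t is Node _ _ then true else false.

Definition tree_of_bool (b : bool) : tree := if b then Node Leaf Leaf else Leaf.

Fixpoint eval (s : store) (e : expr) : tree :=
  match e with
  | Var x => s x
  | ELeaf => Leaf
  | ENode e1 e2 => Node (eval s e1) (eval s e2)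
  | Hd e1 => if eval s e1 is Node a _ then a else Leaf
  | Tl e1 => if eval s e1 is Node _ b then b else Leaf
  | EEq e1 e2 => tree_of_bool (tree_eqb (eval s e1) (eval s e2))
  end.

Fixpoint ecost (s : store) (e : expr) : nat :=
  match e with
  | Var x => tsize (s x)
  | ELeaf => 1
  | ENode e1 e2 | EEq e1 e2 => (ecost s e1 + ecost s e2).+1
  | Hd e1 | Tl e1 => (ecost s e1).+1
  end.

(* [exec c s s' n]: started in [s], [c] halts in [s'] after time [n] *)
Inductive exec : cmd -> store -> store -> nat -> Prop :=
  | ExecSkip s : exec Skip s s 1
  | ExecAssign s x e :
      exec (Assign x e) s (update s x (eval s e)) (ecost s e).+1
  | ExecSeq c1 c2 s1 s2 s3 n1 n2 :
      exec c1 s1 s2 n1 -> exec c2 s2 s3 n2 ->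
      exec (Seq c1 c2) s1 s3 (n1 + n2).+1
  | ExecIf e c1 c2 s s' n :
      exec (if istrue (eval s e) then c1 else c2) s s' n ->
      exec (If e c1 c2) s s' (ecost s e + n).+1
  | ExecWhileFalse e c s :
      ~~ istrue (eval s e) -> exec (While e c) s s (ecost s e).+1
  | ExecWhileTrue e c s1 s2 s3 n1 n2 :
      istrue (eval s1 e) -> exec c s1 s2 n1 -> exec (While e c) s2 s3 n2 ->
      exec (While e c) s1 s3 (ecost s1 e + n1 + n2).+1.

(* The input and the output are held in variable 0. *)
Definition init_store (t : tree) : store := update (fun _ => Leaf) 0 t.

(* [f], on the inputs satisfying [D], is computable in time polynomial in the
   size of the encoded input *)
Definition polytime (A B : Type) (encA : A -> tree) (encB : B -> tree)
    (D : A -> Prop) (f : A -> B) : Prop :=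
  exists (c : cmd) (p : {poly nat}), forall a : A, D a ->
    exists (s : store) (n : nat),
      [/\ exec c (init_store (encA a)) s n,
          s 0 = encB (f a)
        & n <= (p.[tsize (encA a)])%R].

(** * Encodings *)

Definition enc_pair (A B : Type) (encA : A -> tree) (encB : B -> tree)
  (x : A * B) : tree := Node (encA x.1) (encB x.2).

Definition enc_seq (A : Type) (encA : A -> tree) (s : seq A) : tree :=
  foldr (fun x t => Node (encA x) t) Leaf s.

(* Unary; used for the number of vertices and the names of vertices, so that
   the size of an instance is polynomial in |V| and in the bit length of k and
   of the costs, and conversely. *)
Definition enc_unary (n : nat) : tree := iter n (Node Leaf) Leaf.

Fixpoint enc_pos (p : BinNums.positive) : tree :=
  match p with
  | BinNums.xH => Node Leaf Leaf
  | BinNums.xO q => Node (tree_of_bool false) (enc_pos q)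
  | BinNums.xI q => Node (tree_of_bool true) (enc_pos q)
  end.

Definition enc_binary (n : nat) : tree :=
  if bin_of_nat n is BinNums.Npos p then enc_pos p else Leaf.

Definition enc_int (z : int) : tree :=
  match z with
  | Posz n => Node (tree_of_bool false) (enc_binary n)
  | Negz n => Node (tree_of_bool true) (enc_binary n)
  end.

Definition enc_rat (q : rat) : tree := Node (enc_int (numq q)) (enc_int (denq q)).

(** * Graphs with edge costs *)

(* An undirected edge {u, v} is written as the pair (u, v) with u < v. *)
Definition edge : Type := (nat * nat)%type.

Definition enc_edge : edge -> tree := enc_pair enc_unary enc_unary.

(* The vertex set is {0, ..., nverts - 1}; every edge is listed once, together
   with its cost. *)
Record wgraph := WGraph { nverts : nat; wedges : seq (edge * rat) }.

Definition edges (G : wgraph) : seq edge := [seq x.1 | x <- wedges G].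

Definition wgraph_valid (G : wgraph) : Prop :=
  [/\ uniq (edges G),
      forall e, e \in edges G -> e.1 < e.2 < nverts G
    & forall x, x \in wedges G -> (0 <= x.2)%R].

Definition enc_wgraph (G : wgraph) : tree :=
  Node (enc_unary (nverts G)) (enc_seq (enc_pair enc_edge enc_rat) (wedges G)).

(* A solution is a set of edges, listed without repetition. *)
Definition solution : Type := seq edge.

Definition enc_solution : solution -> tree := enc_seq enc_edge.

Definition edge_subset (G : wgraph) (S : solution) : Prop :=
  uniq S /\ {subset S <= edges G}.

Definition cost (G : wgraph) (S : solution) : rat :=
  (\sum_(x <- wedges G | x.1 \in S) x.2)%R.

Definition adj (S : solution) : rel nat :=
  fun u v => ((u, v) \in S) || ((v, u) \in S).

(* [s :: p] is the sequence of vertices of an s,t-path *)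
Definition st_path (S : solution) (s t : nat) (p : seq nat) : Prop :=
  [/\ path (adj S) s p, last s p = t & uniq (s :: p)].

Definition openly_disjoint (s t : nat) (p q : seq nat) : Prop :=
  forall x, x \in s :: p -> x \in s :: q -> x = s \/ x = t.

(* The paths are required to be distinct because the path consisting of the
   single edge st is openly disjoint from itself. *)
Definition has_openly_disjoint_paths
    (S : solution) (k s t : nat) : Prop :=
  exists P : seq (seq nat),
    [/\ size P = k, uniq P,
        forall p, p \in P -> st_path S s t p
      & forall p q, p \in P -> q \in P -> p != q -> openly_disjoint s t p q].

(** * The two problems *)

Record subset_instance := SubsetInstance {
  sgraph : wgraph;
  sterminals : seq nat;
  sconn : nat }.

Definition subset_valid (J : subset_instance) : Prop :=
  [/\ wgraph_valid (sgraph J), uniq (sterminals J)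
    & forall t, t \in sterminals J -> t < nverts (sgraph J)].

Definition subset_feasible (J : subset_instance) (S : solution) : Prop :=
  edge_subset (sgraph J) S /\
  forall s t, s \in sterminals J -> t \in sterminals J -> s != t ->
    has_openly_disjoint_paths S (sconn J) s t.

Definition subset_cost (J : subset_instance) : solution -> rat :=
  cost (sgraph J).

Definition enc_subset (J : subset_instance) : tree :=
  Node (enc_wgraph (sgraph J))
    (Node (enc_seq enc_unary (sterminals J)) (enc_binary (sconn J))).

Record rooted_instance := RootedInstance {
  rgraph : wgraph;
  rroot : nat;
  rterminals : seq nat;
  rconn : nat }.

Definition rooted_valid (I : rooted_instance) : Prop :=
  [/\ wgraph_valid (rgraph I), rroot I < nverts (rgraph I), uniq (rterminals I)
    & forall t, t \in rterminals I -> t < nverts (rgraph I)].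

Definition root_nonterminal (I : rooted_instance) : Prop :=
  rooted_valid I /\ rroot I \notin rterminals I.

Definition rooted_feasible (I : rooted_instance) (S : solution) : Prop :=
  edge_subset (rgraph I) S /\
  forall t, t \in rterminals I ->
    has_openly_disjoint_paths S (rconn I) (rroot I) t.

Definition rooted_cost (I : rooted_instance) : solution -> rat :=
  cost (rgraph I).

Definition enc_rooted (I : rooted_instance) : tree :=
  Node (enc_wgraph (rgraph I))
    (Node (enc_unary (rroot I))
      (Node (enc_seq enc_unary (rterminals I)) (enc_binary (rconn I)))).

(** * Optimal cost and approximate solutions of a minimization problem *)

Definition is_opt (feas : solution -> Prop) (c : solution -> rat) (x : rat) :
    Prop :=
  (exists2 S, feas S & c S = x) /\ (forall S, feas S -> (x <= c S)%R).

Definition is_approx (feas : solution -> Prop) (c : solution -> rat)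
    (R : realFieldType) (beta : R) (S : solution) : Prop :=
  feas S /\
  exists2 x, is_opt feas c x & (ratr (c S) <= beta * ratr x :> R)%R.

(* Main.v *)
Require Import Defs.
From HB Require Import structures.
From mathcomp Require Import all_boot all_order all_algebra.
From mathcomp Require Import zify.
Import Defs.

Set Implicit Arguments.
Unset Strict Implicit.
Unset Printing Implicit Defensive.

(** Subdivide every edge between the root [r] and a vertex [v] by a new vertex
    [x_v] next to the former root, so that the edge [v x_v] inherits the cost,
    and join all [x_v], together with the new root [r' = x_r], by a clique of
    cost 0.  On an [r',t]-path the part after the last [x_v] is an [r,t]-path of
    the original graph, and conversely an [r,t]-path starting with [v] is
    entered from [r'] through [x_v]; both translations keep paths openly
    disjoint.  The requirement between two terminals [s] and [t] is then
    automatic, because the neighbours of [r'] form a clique: combine [k] paths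
    from [s] to [r'] with [k] paths from [t] to [r'], switching between the two
    families along a stable matching (a kernel of the two orders given by the
    paths) and joining the unmatched paths by edges of the clique.

    For the running times, the transformations are written as functions on
    trees built from pairing, projections, tests and folds whose accumulator
    grows additively; all such functions are computable in polynomial time. *)

(** * Polynomial time *)

Lemma horner_natD (p q : {poly nat}) x : (p + q)%R.[x]%R = p.[x]%R + q.[x]%R.
Proof. exact: hornerD. Qed.

Lemma horner_natM (p q : {poly nat}) x : (p * q)%R.[x]%R = p.[x]%R * q.[x]%R.
Proof. exact: hornerM. Qed.

Lemma horner_natC c x : (c%:P : {poly nat})%R.[x]%R = c.
Proof. exact: hornerC. Qed.

Lemma horner_natX x : ('X : {poly nat})%R.[x]%R = x.
Proof. exact: hornerX. Qed.

Lemma horner_nat_comp (p q : {poly nat}) x : (p \Po q)%R.[x]%R = p.[q.[x]]%R.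
Proof. exact: horner_comp. Qed.

Definition horner_natE :=
  (horner_natD, horner_natM, horner_natC, horner_natX, horner_nat_comp).

(** Coefficients in [nat] are nonnegative, so a time bound may be evaluated at any upper bound of
    the input size. *)
Lemma horner_nat_le (p : {poly nat}) x y : x <= y -> p.[x]%R <= p.[y]%R.
Proof.
move=> lexy; elim/poly_ind: p => [|p c IH]; first by rewrite !horner0.
by rewrite !horner_natE leq_add2r leq_mul.
Qed.

Definition thd (t : tree) := if t is Node a _ then a else Leaf.
Definition ttl (t : tree) := if t is Node _ b then b else Leaf.

Lemma tsize_gt0 t : 0 < tsize t. Proof. by case: t. Qed.

Lemma tsize_thd t : tsize (thd t) <= tsize t.
Proof. by case: t => //= a b; lia. Qed.

Lemma tsize_ttl t : tsize (ttl t) <= tsize t.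
Proof. by case: t => //= a b; lia. Qed.

(* The program computing [f] is a family indexed by the base [b]: it reads its
   argument from variable [b], leaves the result there, makes no assumption on
   the initial contents of the variables above [b] and preserves those below,
   so that programs compose without renaming. *)
Definition computable (f : tree -> tree) :=
  exists (c : nat -> cmd) (p : {poly nat}), forall b s, exists s' n,
    [/\ exec (c b) s s' n, s' b = f (s b), forall y, y < b -> s' y = s y,
        n <= p.[tsize (s b)]%R & tsize (f (s b)) <= p.[tsize (s b)]%R].

Lemma computable_polytime (A B : Type) (encA : A -> tree) (encB : B -> tree)
    (D : A -> Prop) (f : A -> B) (F : tree -> tree) :
  computable F -> (forall a, F (encA a) = encB (f a)) ->
  polytime encA encB D f.
Proof.
move=> [c [p cP]] FE; exists (c 0), p => a _.
have [s [n [ex e0 _ le_n _]]] := cP 0 (init_store (encA a)).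
by exists s, n; rewrite e0 -FE.
Qed.

Lemma updateE s x t : update s x t x = t.
Proof. by rewrite /update eqxx. Qed.

Lemma update_neq s x t y : y != x -> update s x t y = s y.
Proof. by rewrite /update => /negbTE ->. Qed.

Lemma exec_assign s x e t :
  eval s e = t -> exec (Assign x e) s (update s x t) (ecost s e).+1.
Proof. by move=> <-; apply: ExecAssign. Qed.

Lemma computable_assign f (e : nat -> expr) (p : {poly nat}) :
  (forall b s, eval s (e b) = f (s b)) ->
  (forall b s, ecost s (e b) < p.[tsize (s b)]%R) ->
  (forall t, tsize (f t) <= p.[tsize t]%R) ->
  computable f.
Proof.
move=> ev ec sz; exists (fun b => Assign b (e b)), p => b s.
exists (update s b (eval s (e b))), (ecost s (e b)).+1.
split=> //; first exact: ExecAssign.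
- by rewrite updateE.
- by move=> y yb; rewrite update_neq // neq_ltn yb.
Qed.

(** * Elementary computable functions and their closure properties *)

Lemma computable_id : computable id.
Proof.
apply: (@computable_assign _ (fun b => Var b) ('X + 1%:P)%R) => [//|b s|t];
  rewrite !horner_natE /=; lia.
Qed.

Lemma computable_thd : computable thd.
Proof.
apply: (@computable_assign _ (fun b => Hd (Var b)) ('X + 2%:P)%R) => [//|b s|t];
  rewrite !horner_natE /=; first lia.
by have := tsize_thd t; lia.
Qed.

Lemma computable_ttl : computable ttl.
Proof.
apply: (@computable_assign _ (fun b => Tl (Var b)) ('X + 2%:P)%R) => [//|b s|t];
  rewrite !horner_natE /=; first lia.
by have := tsize_ttl t; lia.
Qed.

Lemma computable_teq :
  computable (fun t => tree_of_bool (tree_eqb (thd t) (ttl t))).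
Proof.
apply: (@computable_assign _ (fun b => EEq (Hd (Var b)) (Tl (Var b)))
  (2%:P * 'X + 4%:P)%R) => [//|b s|t]; rewrite !horner_natE /=; first lia.
by case: tree_eqb => /=; lia.
Qed.

Fixpoint const_expr (t : tree) : expr :=
  if t is Node a b then ENode (const_expr a) (const_expr b) else ELeaf.

Lemma computable_const t : computable (fun=> t).
Proof.
have ev s : eval s (const_expr t) = t by elim: t => //= a -> b ->.
have ec s : ecost s (const_expr t) = tsize t by elim: {ev} t => //= a -> b ->.
apply: (@computable_assign _ (fun=> const_expr t) ((tsize t).+1%:P)%R) => [//|b s|u];
  by rewrite !horner_natE // ec.
Qed.

(** The size bound on the result of [g] is what keeps the running time of [f] on it polynomial. *)
Lemma computable_comp f g :
  computable f -> computable g -> computable (fun t => f (g t)).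
Proof.
move=> [cf [pf fP]] [cg [pg gP]].
exists (fun b => Seq (cg b) (cf b)), (pg + (pf \Po pg) + 1%:P)%R => b s.
have [s1 [n1 [ex1 e1 pr1 le1 sz1]]] := gP b s.
have [s2 [n2 [ex2 e2 pr2 le2 sz2]]] := fP b s1.
exists s2, (n1 + n2).+1; rewrite e1 in e2 le2 sz2.
have m := horner_nat_le pf sz1.
split=> //; first exact: ExecSeq ex1 ex2.
- by move=> y yb; rewrite pr2 ?pr1.
- by rewrite !horner_natE; lia.
- by rewrite !horner_natE; lia.
Qed.

(** [f] runs on a copy of the argument in variable [b.+1] and [g] on a copy in [b.+2], so neither
    destroys the argument and [g] leaves the result of [f] intact. *)
Lemma computable_node f g :
  computable f -> computable g -> computable (fun t => Node (f t) (g t)).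
Proof.
move=> [cf [pf fP]] [cg [pg gP]].
exists (fun b => Seq (Assign b.+1 (Var b)) (Seq (cf b.+1)
  (Seq (Assign b.+2 (Var b)) (Seq (cg b.+2)
    (Assign b (ENode (Var b.+1) (Var b.+2))))))).
exists (2%:P * pf + 2%:P * pg + 2%:P * 'X + 10%:P)%R => b s.
set s1 := update s b.+1 (s b).
have [s2 [n2 [ex2 e2 pr2 le2 sz2]]] := fP b.+1 s1.
have s1b : s1 b.+1 = s b by rewrite /s1 updateE.
have s2b : s2 b = s b by rewrite pr2 // /s1 update_neq //; lia.
set s3 := update s2 b.+2 (s2 b).
have [s4 [n4 [ex4 e4 pr4 le4 sz4]]] := gP b.+2 s3.
have s3b : s3 b.+2 = s b by rewrite /s3 updateE s2b.
rewrite s1b in e2 le2 sz2; rewrite s3b in e4 le4 sz4.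
have s4b : s4 b.+1 = f (s b) by rewrite pr4 // /s3 update_neq ?e2 //; lia.
set s5 := update s4 b (Node (s4 b.+1) (s4 b.+2)).
eexists s5, _; split.
- apply: ExecSeq (exec_assign _ _) (ExecSeq ex2 (ExecSeq (exec_assign _ _)
    (ExecSeq ex4 (exec_assign _ _)))) => //.
- by rewrite /s5 updateE s4b e4.
- move=> y yb; rewrite /s5 update_neq; last lia.
  rewrite pr4; last lia.
  rewrite /s3 update_neq; last lia.
  rewrite pr2; last lia.
  by rewrite /s1 update_neq; last lia.
- by rewrite !horner_natE /= s4b e4 s2b; lia.
- by rewrite !horner_natE /=; lia.
Qed.

Lemma computable_eq f g : computable f -> computable g ->
  computable (fun t => tree_of_bool (tree_eqb (f t) (g t))).
Proof.
by move=> cf cg; apply: computable_comp computable_teq (computable_node cf cg).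
Qed.

Lemma computable_if h f g :
  computable h -> computable f -> computable g ->
  computable (fun t => if istrue (h t) then f t else g t).
Proof.
move=> [ch [ph hP]] [cf [pf fP]] [cg [pg gP]].
exists (fun b => Seq (Assign b.+1 (Var b)) (Seq (ch b.+1)
  (If (Var b.+1) (cf b) (cg b)))).
exists (2%:P * ph + pf + pg + 'X + 4%:P)%R => b s.
set s1 := update s b.+1 (s b).
have [s2 [n2 [ex2 e2 pr2 le2 sz2]]] := hP b.+1 s1.
have s1b : s1 b.+1 = s b by rewrite /s1 updateE.
have s2b : s2 b = s b by rewrite pr2 // /s1 update_neq //; lia.
rewrite s1b in e2 le2 sz2.
have [s3 [n3 [ex3 e3 pr3 le3 sz3]]] : exists s' n,
    [/\ exec (if istrue (eval s2 (Var b.+1)) then cf b else cg b) s2 s' n,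
        s' b = (if istrue (h (s b)) then f (s b) else g (s b)),
        forall y, y < b -> s' y = s2 y,
        n <= pf.[tsize (s b)]%R + pg.[tsize (s b)]%R
      & tsize (if istrue (h (s b)) then f (s b) else g (s b)) <=
        pf.[tsize (s b)]%R + pg.[tsize (s b)]%R].
  rewrite /= e2; case: (istrue _).
    have [s3 [n3 [? ? ? ? ?]]] := fP b s2; exists s3, n3.
    by rewrite -s2b; split=> //; lia.
  have [s3 [n3 [? ? ? ? ?]]] := gP b s2; exists s3, n3.
  by rewrite -s2b; split=> //; lia.
exists s3; eexists; split.
- by apply: ExecSeq (exec_assign _ _) (ExecSeq ex2 (ExecIf ex3)).
- exact: e3.
- move=> y yb; rewrite pr3 // pr2; last lia.
  by rewrite /s1 update_neq; last lia.
- by rewrite !horner_natE /= e2; lia.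
- by rewrite !horner_natE /=; lia.
Qed.

(** * Iteration over lists in polynomial time *)

(* The step function receives the context, the whole remaining list (so that
   folding over a unary number enumerates the smaller numbers) and the
   accumulator. *)
Fixpoint tfold (f : tree -> tree) (c acc l : tree) : tree :=
  if l is Node _ l' then tfold f c (f (Node c (Node l acc))) l' else acc.

(* Only additive growth of the accumulator keeps an iteration polynomial. *)
Definition accumulating (f : tree -> tree) := exists q : {poly nat},
  forall c l acc,
    tsize (f (Node c (Node l acc))) <= tsize acc + q.[tsize c + tsize l]%R.

Lemma tsize_tfold f (q : {poly nat}) m c acc l :
  (forall c l acc,
     tsize (f (Node c (Node l acc))) <= tsize acc + q.[tsize c + tsize l]%R) ->
  tsize c + tsize l <= m ->
  tsize (tfold f c acc l) <= tsize acc + tsize l * q.[m]%R.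
Proof.
move=> fq; elim: l acc => [|x _ l IH] acc lem /=; first lia.
have := IH (f (Node c (Node (Node x l) acc))).
have := fq c (Node x l) acc; have := horner_nat_le q lem.
rewrite /= in lem *; move: (q.[_]%R) (q.[_]%R) => u v.
by have := tsize_gt0 x; nia.
Qed.

(** Variable [b] holds the accumulator, [b.+1] the context, [b.+2] the remaining list; [b.+3]
    receives the argument of the step. *)
Definition fold_body (cf : nat -> cmd) (b : nat) : cmd :=
  Seq (Assign b.+3 (ENode (Var b.+1) (ENode (Var b.+2) (Var b))))
    (Seq (cf b.+3) (Seq (Assign b (Var b.+3)) (Assign b.+2 (Tl (Var b.+2))))).

(** [M] bounds the argument of every step of the loop: each round adds at most [q.[m]] to the
    accumulator while the list shrinks, so the hypothesis on [M] passes to the tail. *)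
Lemma fold_loop f (cf : nat -> cmd) (p q : {poly nat}) :
  (forall b s, exists s' n,
    [/\ exec (cf b) s s' n, s' b = f (s b), forall y, y < b -> s' y = s y,
        n <= p.[tsize (s b)]%R & tsize (f (s b)) <= p.[tsize (s b)]%R]) ->
  (forall c l acc,
     tsize (f (Node c (Node l acc))) <= tsize acc + q.[tsize c + tsize l]%R) ->
  forall b m M c l acc s,
  s b = acc -> s b.+1 = c -> s b.+2 = l ->
  tsize c + tsize l <= m ->
  (tsize c + tsize l + tsize acc + tsize l * q.[m]%R).+2 <= M ->
  exists s' n,
    [/\ exec (While (Var b.+2) (fold_body cf b)) s s' n,
        s' b = tfold f c acc l, forall y, y < b -> s' y = s y
      & n <= tsize l * (2 * p.[M]%R + 4 * M + 10)].
Proof.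
move=> cfP fq b m M c; elim=> [|x _ l IH] acc s sb sb1 sb2 lem leM.
  exists s; eexists; split.
  - by apply: ExecWhileFalse; rewrite /= sb2.
  - by rewrite sb.
  - by [].
  - by rewrite /= sb2 /=; lia.
set t := Node c (Node (Node x l) acc).
set s1 := update s b.+3 t.
have [s2 [n2 [ex2 e2 pr2 le2 sz2]]] := cfP b.+3 s1.
have s1b : s1 b.+3 = t by rewrite /s1 updateE.
rewrite s1b in e2 le2 sz2.
have s2E y : y < b.+3 -> s2 y = s y.
  by move=> yb; rewrite pr2 // /s1 update_neq //; lia.
set s3 := update s2 b (f t).
set s4 := update s3 b.+2 l.
have tM : tsize t <= M by rewrite /= in leM *; lia.
have ft : tsize (f t) <= tsize acc + q.[m]%R.
  by apply: leq_trans (fq _ _ _) _; rewrite leq_add2l horner_nat_le.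
have [|||||s5 [n5 [ex5 e5 pr5 le5]]] := IH (f t) s4 _ _ _ _ _.
- by rewrite /s4 /s3 update_neq ?updateE //; lia.
- rewrite /s4 /s3 update_neq; last lia.
  rewrite update_neq; last lia.
  by rewrite s2E // ltnS leqW.
- by rewrite /s4 updateE.
- by rewrite /= in lem; lia.
- by move: (q.[m]%R) ft leM => u; rewrite /= => ft leM; have := tsize_gt0 x; nia.
exists s5; eexists; split.
- apply: ExecWhileTrue ex5; first by rewrite /= sb2.
  apply: ExecSeq (exec_assign _ _)
    (ExecSeq ex2 (ExecSeq (exec_assign _ _) (exec_assign _ _))) => //=.
    by rewrite sb sb1 sb2.
  rewrite update_neq; last lia.
  by rewrite s2E // sb2.
- by rewrite e5.
- move=> y yb; rewrite pr5 // /s4 update_neq; last lia.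
  rewrite /s3 update_neq; last lia.
  by rewrite s2E; last lia.
- have s3b : s3 b.+2 = Node x l.
    rewrite /s3 update_neq; last lia.
    by rewrite s2E.
  rewrite /= -/s3 s3b sb sb1 sb2 e2.
  have := horner_nat_le p tM; move: (p.[_]%R) (p.[M]%R) le2 sz2 le5 tM.
  by move=> u v; rewrite /= => *; have := tsize_gt0 x; nia.
Qed.

Lemma computable_tfold f fc fa fl :
  computable f -> accumulating f ->
  computable fc -> computable fa -> computable fl ->
  computable (fun t => tfold f (fc t) (fa t) (fl t)).
Proof.
move=> [cf [p cfP]] [q fq] cfc cfa cfl.
suff base : computable
    (fun t => tfold f (thd t) (thd (ttl t)) (ttl (ttl t))).
  apply: (computable_comp base (computable_node cfc (computable_node cfa cfl))).
(* [r] provides the bound [M] of [fold_loop] for an input of size [x]: context, list and accumulator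
   have size at most [x] each, and [m] is [2 * x]. *)
have [r rE] : exists r : {poly nat},
    forall x, r.[x]%R = 3 * x + 2 + x * q.[2 * x]%R.
  exists (3%:P * 'X + 2%:P + 'X * (q \Po (2%:P * 'X)))%R => x.
  by rewrite !horner_natE.
exists (fun b => Seq (Assign b.+1 (Hd (Var b)))
  (Seq (Assign b.+2 (Tl (Tl (Var b))))
  (Seq (Assign b (Hd (Tl (Var b))))
       (While (Var b.+2) (fold_body cf b))))).
exists ('X * (2%:P * (p \Po r) + 4%:P * r + 10%:P) + 3%:P * 'X + 15%:P + r)%R.
move=> b s; set t := s b; set N := tsize t.
set s1 := update s b.+1 (thd t).
set s2 := update s1 b.+2 (ttl (ttl t)).
set s3 := update s2 b (thd (ttl t)).
have s1b : s1 b = t by rewrite /s1 update_neq //; lia.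
have s2b : s2 b = t by rewrite /s2 update_neq //; lia.
have szc : tsize (thd t) <= N := tsize_thd t.
have sza : tsize (thd (ttl t)) <= N := leq_trans (tsize_thd _) (tsize_ttl t).
have szl : tsize (ttl (ttl t)) <= N := leq_trans (tsize_ttl _) (tsize_ttl t).
have lem : tsize (thd t) + tsize (ttl (ttl t)) <= 2 * N by lia.
have [||||s4 [n4 [ex4 e4 pr4 le4]]] :=
    @fold_loop f cf p q cfP fq b (2 * N) r.[N]%R (thd t) (ttl (ttl t))
      (thd (ttl t)) s3 _ _ _ lem _.
- by rewrite /s3 updateE.
- rewrite /s3 update_neq; last lia.
  rewrite /s2 update_neq; last lia.
  by rewrite /s1 updateE.
- rewrite /s3 update_neq; last lia.
  by rewrite /s2 updateE.
- rewrite rE; have := leq_mul szl (leqnn q.[2 * N]%R).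
  by move: (q.[_]%R) => u; nia.
exists s4; eexists; split.
- apply: ExecSeq (exec_assign _ _) (ExecSeq (exec_assign _ _)
    (ExecSeq (exec_assign _ _) ex4)) => //=; first by rewrite s1b.
  by rewrite s2b.
- exact: e4.
- move=> y yb; rewrite pr4 // /s3 update_neq; last lia.
  rewrite /s2 update_neq; last lia.
  by rewrite /s1 update_neq; last lia.
- rewrite !horner_natE /= -/t s1b s2b -/N.
  have := leq_trans le4 (leq_mul szl (leqnn _)).
  by move: (N * _) => u; lia.
- apply: leq_trans (tsize_tfold _ fq lem) _.
  rewrite !horner_natE -/N [X in _ <= _ + X]rE.
  have := leq_mul szl (leqnn q.[2 * N]%R).
  by move: (tsize (ttl _) * _) (N * (_ + _)) (N * q.[_]%R) => w u v; lia.
Qed.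

(** * Linking two families of paths *)

Lemma minimal_below (V : finType) (lt : rel V) (X : {set V}) (v : V) :
  irreflexive lt -> transitive lt -> v \in X ->
  exists2 u, u \in X & ((u == v) || lt u v) /\ forall w, w \in X -> ~~ lt w u.
Proof.
move=> irr tr vX.
pose ok u := (u \in X) && ((u == v) || lt u v).
have okv : ok v by rewrite /ok vX eqxx.
(* Among the candidates, one with the fewest predecessors in [X] is minimal: by transitivity any
   predecessor would have strictly fewer. *)
case: (arg_minnP (fun u => #|[set w in X | lt w u]|) okv) => u.
case/andP=> uX uv umin; exists u => //; split=> // w wX; apply/negP => wu.
have okw : ok w.
  rewrite /ok wX; case/orP: uv => [/eqP <-|uv]; first by rewrite wu orbT.
  by rewrite (tr _ _ _ wu uv) orbT.
have := umin _ okw; apply/negP; rewrite -ltnNge; apply: proper_card.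
apply/properP; split.
  apply/subsetP => y; rewrite !inE => /andP[-> yw] /=; exact: tr yw wu.
by exists w; rewrite !inE wX ?wu // irr.
Qed.

(* Sands, Sauer and Woodrow: the union of two partial orders has a kernel.
   With X the candidates of the first order and Y those of the second, the
   least fixed point makes each set the complement of what the other rejects. *)
Lemma two_orders_kernel (V : finType) (lt1 lt2 : rel V) :
  irreflexive lt1 -> transitive lt1 -> irreflexive lt2 -> transitive lt2 ->
  exists Z : {set V},
    {in Z &, forall u v, ~~ lt1 u v && ~~ lt2 u v} /\
    forall v, v \in Z \/ exists2 z, z \in Z & lt1 z v || lt2 z v.
Proof.
move=> irr1 tr1 irr2 tr2.
pose rej (lt : rel V) (X : {set V}) := [set v in X | [exists u in X, lt u v]].
have rej_mono lt (X Y : {set V}) : X \subset Y -> rej lt X \subset rej lt Y.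
  move=> XY; apply/subsetP => v; rewrite !inE => /andP[vX /existsP[u /andP[uX uv]]].
  rewrite (subsetP XY) //=; apply/existsP; exists u.
  by rewrite (subsetP XY).
pose F X := ~: rej lt2 (~: rej lt1 X).
have F_mono : {homo F : X Y / X \subset Y}.
  by move=> X Y XY; rewrite setCS rej_mono // setCS rej_mono.
pose X := fixset F; pose Y := ~: rej lt1 X.
have XE : X = ~: rej lt2 Y by rewrite /X -{1}(fixsetK F_mono).
have inY v : (v \in Y) = (v \notin rej lt1 X) by rewrite inE.
have inX v : (v \in X) = (v \notin rej lt2 Y) by rewrite {1}XE inE.
have noX u v : u \in X -> v \in X -> v \in Y -> ~~ lt1 u v.
  move=> uX vX; rewrite inY inE vX /=; apply: contraNN => uv.
  by apply/existsP; exists u; rewrite uX.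
have noY u v : u \in Y -> v \in Y -> v \in X -> ~~ lt2 u v.
  move=> uY vY; rewrite inX inE vY /=; apply: contraNN => uv.
  by apply/existsP; exists u; rewrite uY.
exists (X :&: Y); split.
  move=> u v; rewrite !in_setI => /andP[uX uY] /andP[vX vY].
  by rewrite noX ?noY.
(* A minimal member of [X] for [lt1] is not rejected and so lies in [Y] too. If [v] is outside [X],
   it was rejected by [lt2], hence lies in [Y], and the same descent is made there. *)
move=> v; case vX : (v \in X).
  have [u uX [uv umin]] := minimal_below irr1 tr1 vX.
  have uY : u \in Y.
    rewrite inY inE uX /=; apply/negP => /existsP[w /andP[wX wu]].
    by have := umin w wX; rewrite wu.
  case/orP: uv => [/eqP <-|uv]; first by left; rewrite in_setI uX.
  by right; exists u; rewrite ?in_setI ?uX // uv.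
have vY : v \in Y by move/negbT: vX; rewrite inX negbK inE => /andP[].
have [u uY [uv umin]] := minimal_below irr2 tr2 vY.
have uX : u \in X.
  rewrite inX inE uY /=; apply/negP => /existsP[w /andP[wX wu]].
  by have := umin w wX; rewrite wu.
case/orP: uv => [/eqP <-|uv]; first by left; rewrite in_setI uX.
by right; exists u; rewrite ?in_setI ?uX // uv orbT.
Qed.

Lemma two_orders_kernel_seq (T : choiceType) (U : seq T) (lt1 lt2 : rel T) :
  irreflexive lt1 -> transitive lt1 -> irreflexive lt2 -> transitive lt2 ->
  exists Z : seq T,
    [/\ uniq Z, {subset Z <= U},
        {in Z &, forall u v, ~~ lt1 u v && ~~ lt2 u v}
      & {in U, forall v, v \in Z \/ exists2 z, z \in Z & lt1 z v || lt2 z v}].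
Proof.
move=> irr1 tr1 irr2 tr2.
have [||||Z [Zanti Zdom]] := @two_orders_kernel (seq_sub U)
    (fun u v => lt1 (ssval u) (ssval v)) (fun u v => lt2 (ssval u) (ssval v)).
- by move=> u; apply: irr1.
- by move=> u v w; apply: tr1.
- by move=> u; apply: irr2.
- by move=> u v w; apply: tr2.
have memZ z : (ssval z \in [seq ssval x | x <- enum Z]) = (z \in Z).
  by rewrite mem_map ?mem_enum //; apply: val_inj.
exists [seq ssval x | x <- enum Z]; split.
- by rewrite map_inj_uniq ?enum_uniq //; apply: val_inj.
- by move=> _ /mapP[z _ ->]; apply: ssvalP.
- by move=> _ _ /mapP[u + ->] /mapP[v + ->]; rewrite !mem_enum; apply: Zanti.
- move=> v vU; case: (Zdom (SeqSub vU)) => [vZ|[z zZ zv]].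
    by left; rewrite -[v]/(ssval (SeqSub vU)) memZ.
  by right; exists (ssval z); rewrite ?memZ.
Qed.

(** * Families of disjoint paths, cut and matched along a kernel *)

Section Families.

Variable T : choiceType.
Implicit Types (P Q : seq (seq T)) (p q : seq T).

Definition disjoint_family P :=
  [/\ uniq P, all uniq P
    & forall p q v, p \in P -> q \in P -> v \in p -> v \in q -> p = q].

Definition earlier P : rel T := fun u v =>
  has (fun p => [&& u \in p, v \in p & index u p < index v p]) P.

Lemma earlier_irr P : irreflexive (earlier P).
Proof. by move=> u; apply/hasP => -[p _ /and3P[_ _]]; rewrite ltnn. Qed.

(** Disjointness forces the two paths witnessing the comparisons to coincide, as both contain the
    middle vertex. *)
Lemma earlier_trans P : disjoint_family P -> transitive (earlier P).
Proof.
move=> [_ _ dP] v u w /hasP[p pP /and3P[up vp uv]] /hasP[q qP /and3P[vq wq vw]].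
have pq := dP _ _ _ pP qP vp vq; rewrite -pq in wq vw.
by apply/hasP; exists p => //; rewrite up wq (ltn_trans uv vw).
Qed.

(** Two distinct vertices of one path are comparable along it, so a kernel meets each path at most
    once. *)
Lemma earlier_antichain P (Z : seq T) :
  {in Z &, forall u v, ~~ earlier P u v} ->
  {in P, forall p, {in Z &, forall u v, u \in p -> v \in p -> u = v}}.
Proof.
move=> Zanti p pP u v uZ vZ up vp.
case: (ltngtP (index u p) (index v p)) => [uv|vu|].
- by case/hasP: (Zanti u v uZ vZ); exists p => //; rewrite up vp.
- by case/hasP: (Zanti v u vZ uZ); exists p => //; rewrite up vp.
- by move=> e; rewrite -(nth_index u up) e nth_index.
Qed.

(** The first vertex in [Z] is kept. If [p] avoids [Z], [find] returns its length and the cut is all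
    of [p]. *)
Definition cut (Z : seq T) p := take (find (mem Z) p).+1 p.

Lemma cut_sub Z p : {subset cut Z p <= p}.
Proof. by move=> v; apply: mem_take. Qed.

Lemma cut_disjoint Z p : ~~ has (mem Z) p -> cut Z p = p.
Proof. by move=> /hasNfind e; rewrite /cut e take_oversize. Qed.

Lemma mem_cut Z p v : uniq p -> v \in cut Z p ->
  forall z, z \in p -> z \in Z -> index v p <= index z p.
Proof.
move=> up vc z zp zZ; have vp := cut_sub vc.
have h : has (mem Z) p by apply/hasP; exists z.
have le_z : find (mem Z) p <= index z p.
  rewrite leqNgt; apply/negP => lt; have := before_find z lt.
  by rewrite nth_index //= zZ.
apply: leq_trans le_z; by move: vc; rewrite /cut in_take // ltnS.
Qed.

Lemma last_cut Z p x z : z \in Z -> z \in p ->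
  {in Z &, forall u v, u \in p -> v \in p -> u = v} -> last x (cut Z p) = z.
Proof.
move=> zZ zp Z1; have h : has (mem Z) p by apply/hasP; exists z.
rewrite /cut (take_nth x) -?has_find // last_rcons.
by apply: Z1; rewrite ?mem_nth -?has_find //; apply: nth_find.
Qed.

Definition through P z := nth [::] P (find (fun p => z \in p) P).

(** Listing the members that meet [Z] first, in the order of [Z], lets a plain [zip] of two arranged
    families pair the paths through the same kernel vertex, and the remaining paths with each
    other. *)
Definition arrange (Z : seq T) P :=
  [seq through P z | z <- Z] ++ [seq p <- P | ~~ has (mem Z) p].

Lemma throughP P z : z \in flatten P -> through P z \in P /\ z \in through P z.
Proof.
move=> /flattenP zP; have h : has (fun p => z \in p) P by apply/hasP.
by rewrite /through mem_nth -?has_find //; split=> //; apply: (nth_find [::] h).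
Qed.

Lemma perm_arrange Z P :
  disjoint_family P -> uniq Z -> {subset Z <= flatten P} ->
  {in P, forall p, {in Z &, forall u v, u \in p -> v \in p -> u = v}} ->
  perm_eq (arrange Z P) P.
Proof.
move=> [uP _ dP] uZ ZP Z1; apply: uniq_perm => //.
  rewrite cat_uniq filter_uniq // andbT; apply/andP; split.
    rewrite map_inj_in_uniq // => u v uZ' vZ' uv.
    have [[uM uu] [vM vv]] := (throughP (ZP _ uZ'), throughP (ZP _ vZ')).
    by apply: (Z1 _ uM) => //; rewrite uv.
  apply/hasPn => p; rewrite mem_filter => /andP[nZ pP].
  apply: contraNN nZ => /mapP[z zZ ->]; apply/hasP; exists z => //.
  by have [] := throughP (ZP _ zZ).
move=> p; rewrite mem_cat mem_filter; apply/orP/idP => [[/mapP[z zZ ->]|/andP[]//]|pP].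
  by have [] := throughP (ZP _ zZ).
case: (boolP (has (mem Z) p)) => [/hasP[z zp zZ]|]; last by right.
left; apply/mapP; exists z => //.
by have [M zM] := throughP (ZP _ zZ); apply: dP zM.
Qed.

Lemma mem_zip (A B : eqType) (a : seq A) (b : seq B) x :
  x \in zip a b -> x.1 \in a /\ x.2 \in b.
Proof.
elim: a b => [|u a IH] [|v b] //=; rewrite !inE => /orP[/eqP -> /=|/IH[-> ->]].
  by rewrite !eqxx.
by rewrite !orbT.
Qed.

Lemma zip_inj (A B : eqType) (a : seq A) (b : seq B) x y :
  uniq a -> uniq b -> size a = size b -> x \in zip a b -> y \in zip a b ->
  x.1 = y.1 \/ x.2 = y.2 -> x = y.
Proof.
move=> ua ub ab xz yz; have [i ilt <-] := nthP x xz; have [j jlt <-] := nthP x yz.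
have [ia ja] : i < size a /\ j < size a.
  by move: ilt jlt; rewrite size1_zip ?ab.
have [ib jb] : i < size b /\ j < size b by rewrite -ab.
case: x {xz yz ilt jlt} => x1 x2; rewrite !nth_zip //=.
by case=> /eqP; rewrite nth_uniq // => /eqP ->.
Qed.

Variable e : rel T.
(** Stuttering is allowed because two matched halves end at the same kernel vertex, and because a
    path may list its starting point again. *)
Let e0 : rel T := fun u v => (u == v) || e u v.

(* Each path of [P] is followed from [s] until its first vertex in a kernel
   [Z] of the two orders along the paths, and then a path of [Q] back to [t].
   Members missing [Z] are matched arbitrarily and joined at their ends. *)
Lemma linkage P Q s t :
  disjoint_family P -> disjoint_family Q -> size P = size Q ->
  [::] \notin P ->
  {in P, forall p, path e0 s p} -> {in Q, forall q, path e0 t q} ->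
  (forall p q, p \in P -> q \in Q ->
     (forall v q', q' \in Q -> v \in p -> v \in q' -> 0 < index v q') ->
     (forall v p', p' \in P -> v \in q -> v \in p' -> 0 < index v p') ->
     e0 (last s p) (last t q)) ->
  exists L : seq (seq T * seq T),
    [/\ size L = size P, uniq L,
        forall x, x \in L ->
          [/\ path e0 s x.1, path e0 t x.2 & e0 (last s x.1) (last t x.2)]
      & forall x y v, x \in L -> y \in L ->
          v \in x.1 ++ x.2 -> v \in y.1 ++ y.2 -> x = y].
Proof.
move=> dP dQ sPQ P0 pathP pathQ ends.
have [_ /allP uniqP disjP] := dP; have [_ /allP uniqQ disjQ] := dQ.
have [Z [uZ ZU Zanti Zdom]] :=
  two_orders_kernel_seq [seq v <- flatten P | v \in flatten Q]
    (@earlier_irr P) (earlier_trans dP) (@earlier_irr Q) (earlier_trans dQ).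
have ZP : {subset Z <= flatten P}.
  by move=> z /ZU; rewrite mem_filter => /andP[].
have ZQ : {subset Z <= flatten Q}.
  by move=> z /ZU; rewrite mem_filter => /andP[].
have Z1P := @earlier_antichain P Z (fun u v uZ vZ => proj1 (andP (Zanti u v uZ vZ))).
have Z1Q := @earlier_antichain Q Z (fun u v uZ vZ => proj2 (andP (Zanti u v uZ vZ))).
(* A common vertex of the two families is in the kernel or comes after a kernel vertex on one of its
   two paths. *)
have dom p q v : p \in P -> q \in Q -> v \in p -> v \in q ->
    [\/ v \in Z, exists2 z, z \in Z & (z \in p) && (index z p < index v p)
      | exists2 z, z \in Z & (z \in q) && (index z q < index v q)].
  move=> pP qQ vp vq.
  have vU : v \in [seq v <- flatten P | v \in flatten Q].
    rewrite mem_filter; apply/andP; split; apply/flattenP; [by exists q|by exists p].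
  case: (Zdom v vU) => [vZ|[z zZ]]; first by constructor 1.
  case/orP => /hasP[p' p'P /and3P[zp' vp' lt]].
    by constructor 2; exists z => //; rewrite (disjP p p' v) // zp'.
  by constructor 3; exists z => //; rewrite (disjQ q p' v) // zp'.
have permP := perm_arrange dP uZ ZP Z1P.
have permQ := perm_arrange dQ uZ ZQ Z1Q.
have sA : size (arrange Z P) = size (arrange Z Q).
  by rewrite (perm_size permP) (perm_size permQ).
set A := zip (arrange Z P) (arrange Z Q).
have AP x : x \in A -> x.1 \in P.
  by case/mem_zip; rewrite (perm_mem permP).
have AQ x : x \in A -> x.2 \in Q.
  by case/mem_zip; rewrite (perm_mem permQ).
have Acase x : x \in A ->
    (exists2 z, z \in Z & (z \in x.1) && (z \in x.2)) \/
    (~~ has (mem Z) x.1 && ~~ has (mem Z) x.2).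
  rewrite /A /arrange zip_cat ?size_map // mem_cat; case/orP.
    rewrite zip_map => /mapP[z zZ ->]; left; exists z => //=.
    by rewrite !(proj2 (throughP _)) ?ZP ?ZQ.
  case/mem_zip; rewrite !mem_filter => /andP[-> _] /andP[-> _].
  by right.
have Ainj x y : x \in A -> y \in A -> x.1 = y.1 \/ x.2 = y.2 -> x = y.
  apply: zip_inj => //; first by rewrite (perm_uniq permP); case: dP.
  by rewrite (perm_uniq permQ); case: dQ.
(* A cut stops at its first kernel vertex, so a vertex common to two cuts from different families is
   in [Z] itself; it is then the vertex by which [x] was matched. *)
have cross x y v : x \in A -> y \in A -> v \in cut Z x.1 -> v \in cut Z y.2 -> x = y.
  move=> xA yA vx vy; have [xP yQ] := (AP _ xA, AQ _ yA).
  have [vx1 vy2] := (cut_sub vx, cut_sub vy).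
  case: (dom _ _ _ xP yQ vx1 vy2) => [vZ|[z zZ /andP[zx]]|[z zZ /andP[zy]]].
  - case: (Acase _ xA) => [[z zZ /andP[zx1 zx2]]|/andP[/hasP[]]]; last by exists v.
    have zv : z = v := Z1P _ xP _ _ zZ vZ zx1 vx1.
    by apply: Ainj => //; right; apply: (disjQ _ _ v) => //; rewrite ?AQ -?zv.
  - by rewrite ltnNge (mem_cut (uniqP _ xP) vx).
  - by rewrite ltnNge (mem_cut (uniqQ _ yQ) vy).
have Adisj x y v : x \in A -> y \in A ->
    v \in cut Z x.1 ++ cut Z x.2 -> v \in cut Z y.1 ++ cut Z y.2 -> x = y.
  move=> xA yA; rewrite !mem_cat => /orP[vx|vx] /orP[vy|vy].
  - by apply: Ainj => //; left; apply: (disjP _ _ v);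
      rewrite ?AP ?(cut_sub vx) ?(cut_sub vy).
  - exact: cross vx vy.
  - by apply/esym; apply: cross vy vx.
  - by apply: Ainj => //; right; apply: (disjQ _ _ v);
      rewrite ?AQ ?(cut_sub vx) ?(cut_sub vy).
exists [seq (cut Z x.1, cut Z x.2) | x <- A]; split.
- by rewrite size_map size1_zip ?sA // (perm_size permQ).
- rewrite map_inj_in_uniq; last first.
    move=> x y xA yA [xy1 _].
    (* The cut of a nonempty path contains its first vertex, so equal cuts share a vertex. *)
    have : x.1 != [::] by apply: contraNneq P0 => <-; apply: AP.
    case x1 : x.1 => [//|v p] _.
    have vx : v \in cut Z x.1 by rewrite x1 /cut mem_head.
    by apply: (Adisj _ _ v); rewrite ?mem_cat -?xy1 ?vx.
  by apply: zip_uniql; rewrite (perm_uniq permP); case: dP.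
- move=> _ /mapP[x xA ->] /=; have [xP xQ] := (AP _ xA, AQ _ xA).
  rewrite /cut !take_path ?pathP ?pathQ // -!/(cut _ _); split=> //.
  case: (Acase _ xA) => [[z zZ /andP[zx1 zx2]]|/andP[nx1 nx2]].
    rewrite (last_cut s zZ zx1 (Z1P _ xP)) (last_cut t zZ zx2 (Z1Q _ xQ)).
    by rewrite /e0 eqxx.
  (* On a pair avoiding [Z], a vertex shared with a path of the other family is preceded on that
     path by a kernel vertex, so it is not first there; this is what [ends] asks for. *)
  rewrite !cut_disjoint //; apply: ends => //.
    move=> v q qQ vx vq.
    case: (dom _ _ _ xP qQ vx vq) => [vZ|[z zZ /andP[zx _]]|[z zZ /andP[_]]].
    - by case/hasP: nx1; exists v.
    - by case/hasP: nx1; exists z.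
    - exact: leq_ltn_trans.
  move=> v p pP vx vp.
  case: (dom _ _ _ pP xQ vp vx) => [vZ|[z zZ /andP[_]]|[z zZ /andP[zx _]]].
  - by case/hasP: nx2; exists v.
  - exact: leq_ltn_trans.
  - by case/hasP: nx2; exists z.
- move=> _ _ v /mapP[x xA ->] /mapP[y yA ->] /= vx vy.
  by rewrite (Adisj _ _ _ xA yA vx vy).
Qed.

End Families.

(** Puts the common start [s] on one member of its family, so that a path of the other family that
    reaches [s] meets this member at position 0. *)
Lemma disjoint_family_cons (T : choiceType) (s : T) p (P : seq (seq T)) :
  disjoint_family (p :: P) -> {in p :: P, forall q, s \notin q} ->
  disjoint_family ((s :: p) :: P).
Proof.
move=> [/= /andP[pP uP] /andP[up /allP aP] dP] sP.
have sp : s \notin p by apply: sP; rewrite mem_head.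
have sP' q : q \in P -> s \notin q by move=> qP; apply: sP; rewrite inE qP orbT.
split=> /=.
- by rewrite uP andbT; apply/negP => /sP'; rewrite mem_head.
- by rewrite sp up; apply/allP.
have aux q v : q \in P -> v \in s :: p -> v \in q -> s :: p = q.
  move=> qP; rewrite inE => /orP[/eqP ->|vp vq]; first by rewrite (negbTE (sP' _ qP)).
  have pq : p = q by apply: (dP _ _ v); rewrite ?mem_head // inE qP orbT.
  by move: pP; rewrite pq qP.
move=> q q' v; rewrite !inE => /orP[/eqP ->|qP] /orP[/eqP ->|q'P] //.
- exact: aux.
- by move=> vq vp; apply/esym; apply: aux vq.
- by apply: dP; rewrite inE ?qP ?q'P orbT.
Qed.

(** * Openly disjoint paths by way of a vertex whose neighbours form a clique *)

Lemma adj_sym S : symmetric (adj S).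
Proof. by move=> u v; rewrite /adj orbC. Qed.

Lemma path_eq_or (T : eqType) (e : rel T) x p :
  path (fun u v => (u == v) || e u v) x p -> uniq (x :: p) -> path e x p.
Proof.
elim: p x => //= y p IH x /andP[xy py] /andP[xp up].
rewrite IH // andbT; case/orP: xy => // /eqP xy.
by rewrite xy mem_head in xp.
Qed.

(* The paths from [s] to [r] without their end [r], stopped at [t] if they
   meet it. *)
Lemma paths_family S k (s t r : nat) :
  s != r -> t != s -> ~~ adj S s r -> has_openly_disjoint_paths S k s r ->
  exists F : seq (seq nat),
    [/\ size F = k, disjoint_family F, [::] \notin F,
        {in F, forall p, s \notin p}
      & {in F, forall p, path (adj S) s p /\
           (last s p = t \/ adj S (last s p) r)}].
Proof.
move=> sr ts nsr [P [sP uP pP dP]].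
(* [belast s p] is [s] followed by [p] without its end [r]; only the inner vertices remain, and
   there are some because [s] and [r] are not adjacent. *)
pose init p := behead (belast s p).
have initP p : p \in P -> [/\ p = rcons (init p) r, init p != [::],
    path (adj S) s (init p), adj S (last s (init p)) r & uniq (s :: init p)].
  move/pP; case/lastP: p => [|p x] [ep]; rewrite ?last_rcons /=.
    by move=> /eqP; rewrite (negbTE sr).
  move=> xr; rewrite xr in ep * => up; rewrite /init belast_rcons /=.
  move: ep up; rewrite rcons_path rcons_uniq mem_rcons inE negb_or.
  case/andP=> ep lp /andP[/andP[_ ->] /andP[_ ->]]; split=> //.
  by apply: contraNneq nsr => p0; rewrite p0 in lp.
have initD p q v : p \in P -> q \in P -> v \in init p -> v \in init q -> p = q.
  move=> pM qM vp vq; apply/eqP/negPn/negP => pq.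
  have [ep _ _ _ /andP[sp up]] := initP _ pM; have [eq _ _ _ _] := initP _ qM.
  have vr : v != r.
    apply: contraTneq vp => ->; have [_ _] := pP _ pM.
    by rewrite {1}ep /= rcons_uniq => /and3P[].
  have [||vs|vE] := dP _ _ pM qM pq v.
  - by rewrite ep inE mem_rcons inE vp !orbT.
  - by rewrite eq inE mem_rcons inE vq !orbT.
  - by rewrite vs (negbTE sp) in vp.
  - by rewrite vE eqxx in vr.
pose c p := cut [:: t] (init p).
have c0 p : p \in P -> exists2 v, v \in c p & v \in init p.
  move=> /initP[_ + _ _ _]; rewrite /c; case: (init p) => // v q _.
  by exists v; rewrite /cut /= mem_head.
exists [seq c p | p <- P]; split.
- by rewrite size_map.
- split.
  + rewrite map_inj_in_uniq // => p q pM qM pq; have [v vc vp] := c0 _ pM.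
    by apply: (initD _ _ v) => //; rewrite pq in vc; apply: cut_sub vc.
  + apply/allP => _ /mapP[p pM ->]; apply: take_uniq.
    by have [_ _ _ _ /andP[]] := initP _ pM.
  + move=> _ _ v /mapP[p pM ->] /mapP[q qM ->] vp vq.
    by rewrite (initD _ _ v pM qM (cut_sub vp) (cut_sub vq)).
- by apply/negP => /mapP[p pM e0]; have [v] := c0 _ pM; rewrite -e0.
- move=> _ /mapP[p pM ->]; have [_ _ _ _ /andP[sp _]] := initP _ pM.
  by apply: contraNN sp => /cut_sub.
- move=> _ /mapP[p pM ->]; have [_ _ ep lp _] := initP _ pM.
  split; first exact: take_path.
  case: (boolP (t \in init p)) => tp.
    left; apply: last_cut tp _; first by rewrite mem_head.
    by move=> u v; rewrite !inE => /eqP -> /eqP ->.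
  right; rewrite /c cut_disjoint //.
  by apply/hasPn => v vp; apply: contraNN tp => /=; rewrite inE => /eqP <-.
Qed.

(** Link the paths from [s] and from [t] towards [r]; unmatched ones end at neighbours of [r], which
    are equal or adjacent. The linked walks are shortened to paths, and since [s] and [t] are not
    adjacent each keeps an inner vertex, which makes them distinct. *)
Lemma paths_via_simplicial_nonadjacent S k (s t r : nat) :
  s != t -> s != r -> t != r ->
  ~~ adj S s r -> ~~ adj S t r -> ~~ adj S s t ->
  (forall x y, adj S x r -> adj S y r -> x != y -> adj S x y) ->
  has_openly_disjoint_paths S k s r -> has_openly_disjoint_paths S k t r ->
  has_openly_disjoint_paths S k s t.
Proof.
move=> st sr tr nsr ntr nst clique hs ht.
have ts : t != s by rewrite eq_sym.
have [F [sF dF F0 sNF pF]] := paths_family (t := t) sr ts nsr hs.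
have [H [sH dH H0 tNH pH]] := paths_family (t := s) tr st ntr ht.
case: F sF dF F0 sNF pF => [<- _ _ _ _|p0 F sF dF F0 sNF pF].
  by exists [::]; split.
case: H sH dH H0 tNH pH => [/esym|q0 H sH dH H0 tNH pH]; first by rewrite -sF.
have subp : subrel (adj S) (fun u v => (u == v) || adj S u v).
  by move=> u v ->; rewrite orbT.
have pF' p : p \in (s :: p0) :: F ->
    path (fun u v => (u == v) || adj S u v) s p /\
    (last s p = t \/ adj S (last s p) r).
  rewrite inE => /orP[/eqP ->|pM] /=.
    have [pp lp] := pF p0 (mem_head _ _); rewrite eqxx; split=> //.
    exact: sub_path subp _ _ pp.
  have [|pp lp] := pF p; first by rewrite inE pM orbT.
  by split=> //; apply: sub_path subp _ _ pp.
have pH' p : p \in (t :: q0) :: H ->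
    path (fun u v => (u == v) || adj S u v) t p /\
    (last t p = s \/ adj S (last t p) r).
  rewrite inE => /orP[/eqP ->|pM] /=.
    have [pp lp] := pH q0 (mem_head _ _); rewrite eqxx; split=> //.
    exact: sub_path subp _ _ pp.
  have [|pp lp] := pH p; first by rewrite inE pM orbT.
  by split=> //; apply: sub_path subp _ _ pp.
(* A path stopped at [t] meets the member of the other family that [t] was put
   in front of, so it is never left unmatched; likewise for [s]. *)
have [|||||L [sL uL pL dL]] :=
  @linkage _ (adj S) ((s :: p0) :: F) ((t :: q0) :: H) s t
  (disjoint_family_cons dF sNF) (disjoint_family_cons dH tNH) _ _ _ _ _.
- by move: sF sH => /= -> /= ->.
- by move: F0; rewrite !inE /= negb_or => /andP[].
- by move=> p /pF'[].
- by move=> p /pH'[].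
- move=> p q pM qM np nq.
  have [_ [lp|lp]] := pF' _ pM.
    have tp : t \in p.
      by have := mem_last s p; rewrite lp inE (negbTE ts).
    by have := np t _ (mem_head _ _) tp (mem_head _ _); rewrite /= eqxx.
  have [_ [lq|lq]] := pH' _ qM.
    have sq : s \in q.
      by have := mem_last t q; rewrite lq inE (negbTE st).
    by have := nq s _ (mem_head _ _) sq (mem_head _ _); rewrite /= eqxx.
  by case: eqP => //= /eqP; apply: clique.
pose g (x : seq nat * seq nat) := shorten s (x.1 ++ rev (t :: x.2)).
have gP x : x \in L -> [/\ path (adj S) s (g x), last s (g x) = t,
    uniq (s :: g x) & {subset g x <= t :: x.1 ++ x.2}].
  move=> /pL[p1 p2 e12].
  have wp : path (fun u v => (u == v) || adj S u v) s (x.1 ++ rev (t :: x.2)).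
    rewrite cat_path p1 lastI rev_rcons /= e12 rev_path.
    by rewrite (eq_path (e' := fun u v => (u == v) || adj S u v)) // => u v;
      rewrite eq_sym adj_sym.
  have wl : last s (x.1 ++ rev (t :: x.2)) = t.
    by rewrite last_cat rev_cons last_rcons.
  rewrite /g; move: wl; case: (shortenP wp) => p' pp' up' sub lp'; split=> //.
    exact: path_eq_or.
  by move=> v /sub; rewrite mem_cat mem_rev !inE mem_cat orbCA.
have gne x : x \in L -> exists2 v, v \in g x & (v != s) && (v != t).
  move=> /gP[]; case: (g x) => [|v p] /=; first by move=> _ /eqP; rewrite (negbTE st).
  case/andP=> sv _ lp /and3P[]; rewrite inE negb_or => /andP[svn _] vp _ _.
  exists v; first exact: mem_head.
  rewrite eq_sym svn /=; apply: contraNneq nst => vt; rewrite -vt //.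
have gD x y v : x \in L -> y \in L -> v \in g x -> v \in g y -> v != t -> x = y.
  move=> xL yL vx vy vt; have [_ _ _ sx] := gP _ xL; have [_ _ _ sy] := gP _ yL.
  apply: (dL _ _ v) => //.
    by have := sx _ vx; rewrite inE (negbTE vt).
  by have := sy _ vy; rewrite inE (negbTE vt).
exists [seq g x | x <- L]; split.
- by rewrite size_map sL.
- rewrite map_inj_in_uniq // => x y xL yL xy.
  have [v vx /andP[_ vt]] := gne _ xL.
  by apply: (gD _ _ v) => //; rewrite -xy.
- by move=> _ /mapP[x xL ->]; have [? ? ? _] := gP _ xL; split.
- move=> _ _ /mapP[x xL ->] /mapP[y yL ->] xy v; rewrite !inE.
  case/orP => [/eqP|vx]; first by left.
  case/orP => [/eqP|vy]; first by left.
  right; apply/eqP; apply: contraNT xy => vt.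
  by rewrite (gD _ _ v xL yL).
Qed.

Definition drop_edge (S : solution) (s t : nat) : solution :=
  [seq x <- S | (x != (s, t)) && (x != (t, s))].

Lemma drop_edgeC S s t : drop_edge S s t = drop_edge S t s.
Proof. by apply: eq_filter => x; rewrite andbC. Qed.

Lemma adj_drop_edge S s t u v :
  adj (drop_edge S s t) u v =
  adj S u v && ((u, v) != (s, t)) && ((u, v) != (t, s)).
Proof.
rewrite /adj /drop_edge !mem_filter !xpair_eqE.
rewrite ![(v == _) && (u == _)]andbC.
case: ((u, v) \in S); case: ((v, u) \in S);
  by case: ((u == s) && (v == t)); case: ((u == t) && (v == s)).
Qed.

(** A simple path from [s] can use the edge [st] only as its first step, and at most one of the
    paths visits the inner vertex [t]. That path is discarded, or the first one if no path starts
    with the edge. *)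
Lemma paths_drop_edge S k (s t r : nat) :
  t != s -> t != r -> has_openly_disjoint_paths S k s r ->
  has_openly_disjoint_paths (drop_edge S s t) k.-1 s r.
Proof.
move=> ts tr [P [sP uP pP dP]].
have keep p : st_path S s r p -> head s p != t -> st_path (drop_edge S s t) s r p.
  case=> ep lp up hp; split=> //; case: p ep lp up hp => //= v p.
  case/andP=> sv vp lp /andP[sNp uvp] vt.
  rewrite adj_drop_edge sv !xpair_eqE eqxx (negbTE vt) /= [s == t]eq_sym (negbTE ts) /=.
  rewrite -(eq_in_path (P := predC1 s) (e := adj S)) //.
    move=> u w; rewrite !inE => us ws; rewrite adj_drop_edge !xpair_eqE.
    by rewrite (negbTE us) (negbTE ws) andbF !andbT.
  by apply/allP => u uM; rewrite inE; apply: contraNneq sNp => <-.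
have mk P' : size P' = k.-1 -> uniq P' -> {subset P' <= P} ->
    {in P', forall p, head s p != t} ->
    has_openly_disjoint_paths (drop_edge S s t) k.-1 s r.
  move=> sP' uP' sub hP'; exists P'; split=> //.
    by move=> p pM; apply: keep; [apply/pP/sub | apply: hP'].
  by move=> p q pM qM; apply: dP; apply: sub.
case: (boolP (has (fun p => head s p == t) P)) => [/hasP[p pM /eqP hp]|/hasPn hN].
  apply: (mk (rem p P)).
  - by rewrite size_rem // sP.
  - exact: rem_uniq.
  - by move=> q /mem_rem.
  - move=> q; rewrite mem_rem_uniq // !inE => /andP[qp qM].
    apply/negP => /eqP hq.
    have tmem p' : head s p' = t -> t \in s :: p'.
      by case: p' => [|v p'] /= <-; rewrite !inE eqxx ?orbT.
    have [e|e] := dP _ _ qM pM qp t (tmem _ hq) (tmem _ hp).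
      by rewrite e eqxx in ts.
    by rewrite e eqxx in tr.
apply: (mk (behead P)).
- by rewrite size_behead sP.
- by move: uP; case: (P) => //= p P' /andP[].
- exact: mem_behead.
- by move=> p /mem_behead /hN.
Qed.

(** If [s] and [t] are adjacent, their edge is one of the [k] paths and the others are found after
    deleting it. *)
Lemma paths_via_simplicial S k (s t r : nat) :
  s != t -> s != r -> t != r -> ~~ adj S s r -> ~~ adj S t r ->
  (forall x y, adj S x r -> adj S y r -> x != y -> adj S x y) ->
  has_openly_disjoint_paths S k s r -> has_openly_disjoint_paths S k t r ->
  has_openly_disjoint_paths S k s t.
Proof.
move=> st sr tr nsr ntr clique hs ht.
case: (boolP (adj S s t)) => ast; last first.
  exact: (paths_via_simplicial_nonadjacent (r := r)).
case: k hs ht => [|k] hs ht; first by exists [::]; split.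
have ts : t != s by rewrite eq_sym.
have hs' := paths_drop_edge ts tr hs.
have ht' := paths_drop_edge st sr ht.
rewrite drop_edgeC in ht'.
have [||||P [sP uP pP dP]] :=
  paths_via_simplicial_nonadjacent st sr tr _ _ _ _ hs' ht'.
- by rewrite adj_drop_edge (negbTE nsr).
- by rewrite adj_drop_edge (negbTE ntr).
- by rewrite adj_drop_edge eqxx andbF.
(* The clique survives the deletion because neither [s] nor [t] is a neighbour of [r]. *)
- move=> x y; rewrite !adj_drop_edge => /andP[/andP[xr _] _] /andP[/andP[yr _] _] xy.
  rewrite clique //= !xpair_eqE.
  have xs : x != s by apply: contraNneq nsr => <-.
  have xt : x != t by apply: contraNneq ntr => <-.
  by rewrite (negbTE xs) (negbTE xt).
exists ([:: t] :: P); split=> /=.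
- by rewrite sP.
- rewrite uP andbT; apply/negP => /pP[/=].
  by rewrite adj_drop_edge eqxx andbF.
- move=> p; rewrite inE => /orP[/eqP ->|/pP[pp lp up]].
    by split=> //=; rewrite ?ast // inE st.
  split=> //; apply: sub_path pp => u v; rewrite adj_drop_edge.
  by case/andP => /andP[].
- move=> p q; rewrite !inE => /orP[/eqP ->|pM] /orP[/eqP ->|qM] pq v.
  + by rewrite eqxx in pq.
  + by rewrite !inE => /orP[/eqP|/eqP]; auto.
  + by rewrite [v \in [:: s; t]]inE => _; rewrite !inE => /orP[/eqP|/eqP]; auto.
  + exact: (dP _ _ pM qM pq).
Qed.

(** * The transformations as programs *)

(* [h] and [g] see the context paired with the remaining list, whose head is
   the current item. *)
Definition emit_step (h g : tree -> tree) (t : tree) : tree :=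
  if istrue (h (Node (thd t) (thd (ttl t))))
  then Node (g (Node (thd t) (thd (ttl t)))) (ttl (ttl t))
  else ttl (ttl t).

Definition temit (h g : tree -> tree) : tree -> tree -> tree -> tree :=
  tfold (emit_step h g).

Definition ttrue : tree := Node Leaf Leaf.

(** A unary number is a list of leaves, so adding [a] means pushing one leaf onto [b] per item of
    [a]. *)
Definition tadd (a b : tree) : tree := temit (fun=> ttrue) (fun=> Leaf) Leaf b a.

(** One leaf is emitted per occurrence, and a nonempty list counts as true. *)
Definition tmem (y l : tree) : tree :=
  temit (fun t => tree_of_bool (tree_eqb (thd t) (thd (ttl t)))) (fun=> Leaf)
    y Leaf l.

(** The context pairs [n] with the outer index; the inner index is the tail of the remaining unary
    number, so indices run down to 0. *)
Definition tclique_edge (t : tree) : tree :=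
  Node (tadd (thd (thd t)) (ttl (ttl t))) (tadd (thd (thd t)) (ttl (thd t))).

Definition tclique_step (t : tree) : tree :=
  temit (fun=> ttrue) tclique_edge (Node (thd t) (ttl (thd (ttl t))))
    (ttl (ttl t)) (ttl (thd (ttl t))).

Definition tclique (n : tree) : tree := tfold tclique_step n Leaf n.

Definition tsplit (c e : tree) : tree :=
  if istrue (tree_of_bool (tree_eqb (thd e) (ttl c)))
  then Node (ttl e) (tadd (thd c) (ttl e))
  else if istrue (tree_of_bool (tree_eqb (ttl e) (ttl c)))
  then Node (thd e) (tadd (thd c) (thd e)) else e.

(** On an encoded rooted instance this is the number of vertices paired with the root, the context
    of [tsplit]. *)
Definition troot_ctx (t : tree) : tree := Node (thd (thd t)) (thd (ttl t)).

Definition treduce (t : tree) : tree :=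
  Node
    (Node (tadd (thd (thd t)) (thd (thd t)))
       (temit (fun=> ttrue) (fun u => Node (thd (ttl u)) (enc_rat 0)) Leaf
          (temit (fun=> ttrue)
             (fun u => Node (tsplit (thd u) (thd (thd (ttl u))))
                            (ttl (thd (ttl u))))
             (troot_ctx t) Leaf (ttl (thd t)))
          (tclique (thd (thd t)))))
    (Node (Node (tadd (thd (thd t)) (thd (ttl t))) (thd (ttl (ttl t))))
       (ttl (ttl (ttl t)))).

Definition tto_subset (t : tree) : tree :=
  temit (fun=> ttrue) (fun u => tsplit (thd u) (thd (ttl u)))
    (troot_ctx (thd t)) (tclique (thd (thd (thd t)))) (ttl t).

Definition tto_rooted (t : tree) : tree :=
  temit
    (fun u => tmem (tsplit (thd (thd u)) (thd (thd (ttl u)))) (ttl (thd u)))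
    (fun u => thd (thd (ttl u)))
    (Node (troot_ctx (thd t)) (ttl t)) Leaf (ttl (thd (thd t))).

(** * Polynomial running time of the programs *)

Lemma computable_thd_of f : computable f -> computable (fun t => thd (f t)).
Proof. exact: computable_comp computable_thd. Qed.

Lemma computable_ttl_of f : computable f -> computable (fun t => ttl (f t)).
Proof. exact: computable_comp computable_ttl. Qed.

Lemma computable_emit_step h g :
  computable h -> computable g -> computable (emit_step h g).
Proof.
move=> ch cg.
have ct : computable (fun t => Node (thd t) (thd (ttl t))).
  apply: computable_node computable_thd _.
  exact: computable_thd_of computable_ttl.
have ca : computable (fun t => ttl (ttl t)) := computable_ttl_of computable_ttl.
apply: (computable_if (computable_comp ch ct) _ ca).
exact: computable_node (computable_comp cg ct) ca.
Qed.

(** [g] never sees the accumulator, so a step adds at most one node and a tree of size polynomial in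
    the context and the remaining list. *)
Lemma accumulating_emit_step h g : computable g -> accumulating (emit_step h g).
Proof.
move=> [cg [p gP]]; exists ((p \Po ('X + 1%:P)) + 1%:P)%R => c l acc.
have [_ [_ [_ _ _ _]]] := gP 0 (fun=> Node c l).
have := @horner_nat_le p (tsize (Node c l)) (tsize c + tsize l + 1).
rewrite /emit_step !horner_natE /= addn1 leqnn => /(_ isT).
by case: (istrue _) => /=; lia.
Qed.

Lemma computable_temit h g fc fa fl :
  computable h -> computable g ->
  computable fc -> computable fa -> computable fl ->
  computable (fun t => temit h g (fc t) (fa t) (fl t)).
Proof.
move=> ch cg; apply: computable_tfold.
  exact: computable_emit_step.
exact: accumulating_emit_step.
Qed.

Lemma computable_tadd f g :
  computable f -> computable g -> computable (fun t => tadd (f t) (g t)).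
Proof.
move=> cf cg; apply: computable_temit => //; exact: computable_const.
Qed.

Ltac computability := repeat first
  [ simple apply computable_id | simple apply computable_const
  | simple apply computable_tadd | simple apply computable_thd_of
  | simple apply computable_ttl_of | simple apply computable_node
  | simple apply computable_eq | simple apply computable_temit
  | simple apply computable_if ].

Lemma computable_tmem f g :
  computable f -> computable g -> computable (fun t => tmem (f t) (g t)).
Proof. by move=> cf cg; rewrite /tmem; computability. Qed.

Lemma computable_tsplit f g :
  computable f -> computable g -> computable (fun t => tsplit (f t) (g t)).
Proof. by move=> cf cg; rewrite /tsplit; computability. Qed.

Lemma computable_tclique_edge : computable tclique_edge.
Proof. by rewrite /tclique_edge; computability. Qed.

(** A run of the inner loop makes at most [tsize l] additive steps, so it is itself an accumulating
    step for the outer loop. *)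
Lemma computable_tclique f : computable f -> computable (fun t => tclique (f t)).
Proof.
move=> cf; apply: computable_tfold => //; last exact: computable_const.
  by rewrite /tclique_step; computability; exact: computable_tclique_edge.
have [q gq] := accumulating_emit_step (fun=> ttrue) computable_tclique_edge.
exists ('X * (q \Po (2%:P * 'X + 1%:P)))%R => c l acc.
rewrite /tclique_step /=; set m := 2 * (tsize c + tsize l) + 1.
have szl := tsize_ttl l.
apply: leq_trans (tsize_tfold (m := m) _ gq _) _; first by rewrite /m /=; lia.
by rewrite leq_add2l !horner_natE leq_mul // /m; lia.
Qed.

Lemma computable_treduce : computable treduce.
Proof.
rewrite /treduce /troot_ctx; computability.
  by apply: computable_tsplit; computability.
by apply: computable_tclique; computability.
Qed.

Lemma computable_tto_subset : computable tto_subset.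
Proof.
rewrite /tto_subset /troot_ctx; computability.
  by apply: computable_tsplit; computability.
by apply: computable_tclique; computability.
Qed.

Lemma computable_tto_rooted : computable tto_rooted.
Proof.
rewrite /tto_rooted /troot_ctx; computability.
apply: computable_tmem; computability.
by apply: computable_tsplit; computability.
Qed.

(** * The transformations on graphs and their agreement with the programs *)

Definition split_edge (n r : nat) (e : edge) : edge :=
  if e.1 == r then (e.2, n + e.2)
  else if e.2 == r then (e.1, n + e.1) else e.

(** All [n + v] with [v < n] take part, whether or not [v] is a neighbour of the root. *)
Definition clique (n : nat) : seq edge :=
  [seq (n + b, n + a) | a <- iota 0 n, b <- iota 0 a].

(* [n + v] subdivides the edge from the root to [v]; the subdivision vertices,
   together with the new root [n + r], form a clique of cost 0. *)
Definition reduce (I : rooted_instance) : subset_instance :=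
  let n := nverts (rgraph I) in let r := rroot I in
  SubsetInstance
    (WGraph (n + n)
       (rev ([seq (split_edge n r x.1, x.2) | x <- wedges (rgraph I)]
             ++ [seq (e, 0%R) | e <- clique n])))
    (n + r :: rterminals I) (rconn I).

(** The whole clique is bought, at cost 0. The [rev] reflects that emission reverses the order. *)
Definition to_subset (x : rooted_instance * solution) : solution :=
  let n := nverts (rgraph x.1) in
  rev (map (split_edge n (rroot x.1)) x.2) ++ clique n.

Definition to_rooted (x : rooted_instance * solution) : solution :=
  rev [seq e <- edges (rgraph x.1)
      | split_edge (nverts (rgraph x.1)) (rroot x.1) e \in x.2].

Lemma tree_eqb_unary m n : tree_eqb (enc_unary m) (enc_unary n) = (m == n).
Proof. by elim: m n => [|m IH] [|n] //; exact: IH. Qed.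

Lemma tree_eqb_edge (e f : edge) : tree_eqb (enc_edge e) (enc_edge f) = (e == f).
Proof. by case: e f => [a b] [c d] /=; rewrite !tree_eqb_unary xpair_eqE. Qed.

Lemma istrue_tree_of_bool b : istrue (tree_of_bool b) = b.
Proof. by case: b. Qed.

Lemma temit_cons h g c acc x l :
  temit h g c acc (Node x l) =
  temit h g c (if istrue (h (Node c (Node x l)))
               then Node (g (Node c (Node x l))) acc else acc) l.
Proof. by []. Qed.

Lemma temit_enc (A B : Type) (encA : A -> tree) (encB : B -> tree) h g c
    (ph : pred A) (pg : A -> B) acc l :
  (forall x u, istrue (h (Node c (Node (encA x) u))) = ph x) ->
  (forall x u, g (Node c (Node (encA x) u)) = encB (pg x)) ->
  temit h g c (enc_seq encB acc) (enc_seq encA l) =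
  enc_seq encB (rev [seq pg x | x <- l & ph x] ++ acc).
Proof.
move=> hP gP; elim: l acc => //= x l IH acc.
rewrite temit_cons hP gP.
by case: (ph x); rewrite /= -?[Node _ _]/(enc_seq encB (_ :: _)) IH // rev_cons cat_rcons.
Qed.

Lemma tadd_enc m n : tadd (enc_unary m) (enc_unary n) = enc_unary (m + n).
Proof.
rewrite /tadd; elim: m n => [|m IH] n //.
rewrite [enc_unary m.+1]/= temit_cons /= -[Node Leaf (enc_unary n)]/(enc_unary n.+1).
by rewrite IH addnS.
Qed.

Lemma tmem_enc (y : edge) (l : seq edge) :
  istrue (tmem (enc_edge y) (enc_seq enc_edge l)) = (y \in l).
Proof.
rewrite /tmem -[X in temit _ _ _ X]/(enc_seq (fun=> Leaf) ([::] : seq edge)).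
rewrite (@temit_enc _ _ _ _ _ _ _ (pred1 y) id) // => [|x u].
  rewrite cats0 map_id -filter_rev -[in RHS]mem_rev.
  by rewrite -has_pred1 has_filter; case: (filter _ _).
by rewrite istrue_tree_of_bool tree_eqb_edge eq_sym.
Qed.

Lemma tclique_enc n : tclique (enc_unary n) = enc_seq enc_edge (clique n).
Proof.
have iotaS m : iota 0 m.+1 = iota 0 m ++ [:: m] by rewrite -addn1 iotaD.
(* Counting down while pushing in front lists the indices in increasing order, so no [rev]
   appears. *)
have row a b acc :
    temit (fun=> ttrue) tclique_edge (Node (enc_unary n) (enc_unary a))
      (enc_seq enc_edge acc) (enc_unary b) =
    enc_seq enc_edge ([seq (n + i, n + a) | i <- iota 0 b] ++ acc).
  elim: b acc => // b IH acc; rewrite iotaS map_cat -catA.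
  rewrite [enc_unary b.+1]/= temit_cons /= {2}/tclique_edge /= !tadd_enc.
  rewrite -[Node _ (enc_seq _ _)]/(enc_seq enc_edge ((n + b, n + a) :: acc)).
  exact: IH.
suff gen m acc : tfold tclique_step (enc_unary n) (enc_seq enc_edge acc) (enc_unary m) =
    enc_seq enc_edge ([seq (n + b, n + a) | a <- iota 0 m, b <- iota 0 a] ++ acc).
  by rewrite /tclique -[Leaf in LHS]/(enc_seq enc_edge [::]) gen cats0.
elim: m acc => // m IH acc; rewrite iotaS map_cat flatten_cat -catA.
by rewrite [enc_unary m.+1]/= [LHS]/= {2}/tclique_step [ttl _]/= row IH /= cats0.
Qed.

Lemma tsplit_enc n r e :
  tsplit (Node (enc_unary n) (enc_unary r)) (enc_edge e) =
  enc_edge (split_edge n r e).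
Proof.
case: e => u v; rewrite /tsplit /split_edge /= !istrue_tree_of_bool !tree_eqb_unary.
by case: (u == r); case: (v == r); rewrite ?tadd_enc.
Qed.

Lemma treduce_enc I : treduce (enc_rooted I) = enc_subset (reduce I).
Proof.
case: I => [[n E] r T k]; rewrite /treduce /reduce /enc_subset /enc_wgraph /=.
rewrite !tadd_enc; congr (Node (Node _ _) _).
rewrite tclique_enc.
rewrite -[X in temit _ _ (troot_ctx _) X]/(enc_seq (enc_pair enc_edge enc_rat) [::]).
rewrite (@temit_enc _ _ _ (enc_pair enc_edge enc_rat) _ _ _ xpredT
  (fun x => (split_edge n r x.1, x.2))) //=; last first.
  by move=> x u; rewrite /troot_ctx /= tsplit_enc.
rewrite (@temit_enc _ _ _ (enc_pair enc_edge enc_rat) _ _ _ xpredT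
  (fun e => (e, 0%R))) //=.
by rewrite !filter_predT cats0 rev_cat.
Qed.

Lemma tto_subset_enc x :
  tto_subset (enc_pair enc_rooted enc_solution x) = enc_solution (to_subset x).
Proof.
case: x => [[[n E] r T k] S]; rewrite /tto_subset /to_subset /= tclique_enc.
rewrite (@temit_enc _ _ _ enc_edge _ _ _ xpredT (split_edge n r)) //=.
  by rewrite filter_predT.
by move=> x u; rewrite /troot_ctx /= tsplit_enc.
Qed.

Lemma tto_rooted_enc x :
  tto_rooted (enc_pair enc_rooted enc_solution x) = enc_solution (to_rooted x).
Proof.
case: x => [[[n E] r T k] S]; rewrite /tto_rooted /to_rooted /=.
rewrite -[X in temit _ _ _ X]/(enc_seq enc_edge [::]).
rewrite (@temit_enc _ _ (enc_pair enc_edge enc_rat) enc_edge _ _ _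
  (fun x => split_edge n r x.1 \in S) fst) //=; last first.
  by move=> x u; rewrite /troot_ctx /= tsplit_enc tmem_enc.
by rewrite cats0 /edges filter_map.
Qed.

(** * The reduction *)

Lemma paths_sym S k s t :
  has_openly_disjoint_paths S k s t -> has_openly_disjoint_paths S k t s.
Proof.
move=> [P [sP uP pP dP]]; pose g p := rev (belast s p).
have gE p : p \in P -> rev (t :: g p) = s :: p.
  by move=> /pP[_ lp _]; rewrite rev_cons revK -lp -lastI.
exists [seq g p | p <- P]; split.
- by rewrite size_map.
- rewrite map_inj_in_uniq // => p q pM qM pq.
  by have := gE _ pM; rewrite pq gE // => -[].
- move=> _ /mapP[p pM ->]; have [ep lp up] := pP _ pM; split.
  + rewrite -lp rev_path; apply: sub_path ep => u v.
    by rewrite adj_sym.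
  + by rewrite -[t]lp /g; case: (p) => //= v q; rewrite rev_cons last_rcons.
  + by rewrite -rev_uniq gE.
- move=> _ _ /mapP[p pM ->] /mapP[q qM ->] pq v.
  rewrite -[_ \in t :: g p]mem_rev -[_ \in t :: g q]mem_rev !gE // => vp vq.
  have npq : p != q by apply: contraNneq pq => ->.
  by have [] := dP _ _ pM qM npq v vp vq; auto.
Qed.

Lemma mem_clique n x y : ((x, y) \in clique n) = (n <= x < y) && (y < n + n).
Proof.
apply/allpairsPdep/idP => [[a [b [+ + [-> ->]]]]|].
  by rewrite !mem_iota; lia.
move=> h; exists (y - n), (x - n); rewrite !mem_iota.
split; [lia | lia | congr (_, _); lia].
Qed.

Lemma uniq_clique n : uniq (clique n).
Proof.
apply: allpairs_uniq_dep; first exact: iota_uniq.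
  by move=> a _; apply: iota_uniq.
move=> [a b] [c d] _ _ /= [eb ea].
have ac : a = c by lia.
have bd : b = d by lia.
by rewrite ac bd.
Qed.

(** * Validity and costs of the constructed instance *)

Section Reduction.

Variable I : rooted_instance.
Hypothesis I_ok : root_nonterminal I.

Let n := nverts (rgraph I).
Let r := rroot I.
Let E := edges (rgraph I).
Let f := split_edge n r.

Lemma root_bound : r < n. Proof. by case: I_ok => -[]. Qed.

Lemma edge_bound e : e \in E -> e.1 < e.2 < n.
Proof. by case: I_ok => -[[_ + _] _ _ _] _; apply. Qed.

Lemma terminal_bound t : t \in rterminals I -> t < n.
Proof. by case: I_ok => -[_ _ _ +] _; apply. Qed.

Lemma terminal_neq_root t : t \in rterminals I -> t != r.
Proof. by move=> tT; apply: contraTneq tT => ->; case: I_ok. Qed.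

Variant split_spec (e : edge) : edge -> Prop :=
  | SplitRoot v of v != r & v < n & (e == (r, v)) || (e == (v, r)) :
      split_spec e (v, n + v)
  | SplitOther of e.1 != r & e.2 != r : split_spec e e.

Lemma splitP e : e \in E -> split_spec e (f e).
Proof.
move=> /edge_bound; case: e => u v /= uv; rewrite /f /split_edge /=.
case: (u =P r) => [ur|/eqP ur].
  by apply: SplitRoot; rewrite ?ur ?eqxx //; lia.
case: (v =P r) => [vr|/eqP vr]; last exact: SplitOther.
by apply: SplitRoot; rewrite ?vr ?eqxx ?orbT //; lia.
Qed.

Lemma split_bound e : e \in E -> (f e).1 < n /\ (f e).1 < (f e).2 < n + n.
Proof.
move=> eE; have := edge_bound eE; have := root_bound.
by case: splitP => //= *; lia.
Qed.

(** The second endpoint tells split root edges from the others, and the convention that the smaller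
    endpoint comes first determines the original root edge from [v]. *)
Lemma split_inj : {in E &, injective f}.
Proof.
move=> e1 e2 eE1 eE2; have := edge_bound eE1; have := edge_bound eE2.
case: (splitP eE1) => [v vr vn e1E|_ _]; case: (splitP eE2) => [w wr wn e2E|_ _] //.
- move=> lt2 lt1 [vw _]; move: lt1 lt2; rewrite -vw in e2E.
  by case/orP: e1E => /eqP ->; case/orP: e2E => /eqP -> //=; lia.
- by move=> lt2 _ e; move: lt2; rewrite -e /=; lia.
- by move=> _ lt1 e; move: lt1; rewrite e /=; lia.
Qed.

Lemma split_notin_clique e : e \in E -> f e \notin clique n.
Proof.
move=> /split_bound[]; case: (f e) => x y /= xn _.
by rewrite mem_clique; lia.
Qed.

Lemma edges_reduce : edges (sgraph (reduce I)) = rev (map f E ++ clique n).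
Proof.
rewrite /E /edges /= map_rev map_cat -!map_comp; congr (rev (_ ++ _)).
exact: map_id.
Qed.

Lemma mem_edges_reduce e :
  (e \in edges (sgraph (reduce I))) = (e \in map f E) || (e \in clique n).
Proof. by rewrite edges_reduce mem_rev mem_cat. Qed.

Lemma reduce_valid : subset_valid (reduce I).
Proof.
have [[[uE bE cE] rn uT bT] rT] := I_ok.
split; first split.
- rewrite edges_reduce rev_uniq cat_uniq uniq_clique andbT.
  rewrite map_inj_in_uniq ?uE //=; last exact: split_inj.
  apply/hasPn => e eK; apply/negP => /mapP[e' e'E ee'].
  by have := split_notin_clique e'E; rewrite -ee' eK.
- move=> e; rewrite mem_edges_reduce => /orP[/mapP[e' e'E ->]|].
    by have [_] := split_bound e'E.
  by case: e => x y; rewrite mem_clique /=; lia.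
- move=> x; rewrite mem_rev mem_cat => /orP[/mapP[y yE ->]|/mapP[y _ ->]] //=.
  exact: cE.
- rewrite /= uT andbT; apply/negP => /terminal_bound; rewrite -/n; lia.
- move=> t; rewrite inE => /orP[/eqP ->|/terminal_bound] /=; rewrite -/n -/r.
    by have := root_bound; lia.
  lia.
Qed.

Lemma subset_cost_reduce S :
  subset_cost (reduce I) S =
  (\sum_(x <- wedges (rgraph I) | f x.1 \in S) x.2)%R.
Proof.
rewrite /subset_cost /cost /= (perm_big _ (permEl (perm_rev _))) /= big_cat !big_map /=.
by rewrite [X in (_ + X)%R]big1 ?GRing.addr0.
Qed.

Lemma to_rooted_cost S :
  rooted_cost I (to_rooted (I, S)) = subset_cost (reduce I) S.
Proof.
rewrite subset_cost_reduce /rooted_cost /cost big_mkcond [RHS]big_mkcond.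
apply: eq_big_seq => x xE; rewrite mem_rev mem_filter.
by rewrite -/E (map_f fst xE) andbT.
Qed.

Lemma mem_to_subset S e : {subset S <= E} -> e \in E ->
  (f e \in to_subset (I, S)) = (e \in S).
Proof.
move=> SE eE; rewrite mem_cat mem_rev (negbTE (split_notin_clique eE)) orbF.
apply/mapP/idP => [[e' e'S ee']|eS]; last by exists e.
by rewrite (split_inj eE (SE _ e'S) ee').
Qed.

Lemma to_subset_cost S : {subset S <= E} ->
  subset_cost (reduce I) (to_subset (I, S)) = rooted_cost I S.
Proof.
move=> SE; rewrite subset_cost_reduce /rooted_cost /cost big_mkcond [RHS]big_mkcond.
apply: eq_big_seq => x xE; rewrite mem_to_subset //; exact: map_f xE.
Qed.

Lemma to_subset_edge_subset S : edge_subset (rgraph I) S ->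
  edge_subset (sgraph (reduce I)) (to_subset (I, S)).
Proof.
move=> [uS SE]; split.
  rewrite cat_uniq rev_uniq uniq_clique andbT map_inj_in_uniq ?uS /=; last first.
    by move=> e1 e2 /SE e1E /SE e2E; apply: split_inj.
  apply/hasPn => e eK; rewrite mem_rev; apply/negP => /mapP[e' /SE e'E ee'].
  by have := split_notin_clique e'E; rewrite /f -ee' eK.
move=> e; rewrite mem_edges_reduce mem_cat mem_rev => /orP[/mapP[e' /SE e'E ->]|->].
  by rewrite map_f.
by rewrite orbT.
Qed.

(** * From solutions of the subset problem to rooted solutions *)

Section ToRooted.

Variable S : solution.
Hypothesis S_sub : {subset S <= edges (sgraph (reduce I))}.

Lemma adj_bound u v : adj S u v -> u < n + n.
Proof.
have [[_ bE _] _ _] := reduce_valid.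
by move=> /orP[] /S_sub /bE /=; rewrite -/n; lia.
Qed.

(** Split root edges and clique edges have an endpoint at least [n]; what remains are original edges
    avoiding the root. *)
Lemma adj_low u v : adj S u v -> u < n -> v < n ->
  [/\ u != r, v != r & adj (to_rooted (I, S)) u v].
Proof.
have aux x y : (x, y) \in S -> x < n -> y < n ->
    [/\ x != r, y != r & (x, y) \in to_rooted (I, S)].
  move=> xyS xn yn; have := S_sub xyS; rewrite mem_edges_reduce.
  rewrite mem_clique => /orP[/mapP[e eE xyE]|]; last lia.
  have : e \in to_rooted (I, S) by rewrite mem_rev mem_filter -[_ _ _ e]xyE xyS.
  case: (splitP eE) xyE => [w _ _ _ [_ yE]|er1 er2 xyE].
    by move: yn; rewrite yE; lia.
  by move: er1 er2; rewrite -xyE.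
rewrite /adj => /orP[uv un vn|vu un vn].
  by have [? ? ->] := aux _ _ uv un vn.
by have [? ? ->] := aux _ _ vu vn un; rewrite orbT.
Qed.

(** Only split root edges join an old vertex to a new one. *)
Lemma adj_mixed u v : adj S u v -> u < n -> n <= v ->
  [/\ v = n + u, u != r & adj (to_rooted (I, S)) r u].
Proof.
have [[_ bE _] _ _] := reduce_valid.
move=> uvS un vn.
have {}uvS : (u, v) \in S.
  by case/orP: uvS => // vuS; have := bE _ (S_sub vuS); rewrite /=; lia.
have := S_sub uvS; rewrite mem_edges_reduce mem_clique.
case/orP=> [/mapP[e eE uvE]|]; last lia.
have : e \in to_rooted (I, S) by rewrite mem_rev mem_filter -[_ _ _ e]uvE uvS.
case: (splitP eE) uvE => [w wr wn ew [-> ->]|_ _ uvE]; last first.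
  by have := edge_bound eE; rewrite -uvE /=; lia.
move=> eS; split=> //; move: eS.
by rewrite /adj; case/orP: ew => /eqP -> ->; rewrite ?orbT.
Qed.

(** An old neighbour of [n + r] would have to be [r], which [adj_mixed] excludes. Hence the
    neighbours of the new root lie in the clique. *)
Lemma adj_new_root u : adj S u (n + r) -> n <= u < n + n.
Proof.
move=> a; rewrite (adj_bound a) andbT leqNgt; apply/negP => un.
have [|e /eqP] := adj_mixed a un; first by lia.
by lia.
Qed.

(* the part of [p] after its last subdivision vertex *)
Fixpoint low_suffix (p : seq nat) : seq nat :=
  if p is x :: p' then
    if all (gtn n) p then p else low_suffix p'
  else [::].

Lemma path_low x p : path (adj S) x p -> all (gtn n) (x :: p) ->
  path (adj (to_rooted (I, S))) x p /\ {in p, forall v, v != r}.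
Proof.
elim: p x => [|y p IH] x //= /andP[xy yp] /and3P[xn yn pn].
have [_ yr axy] := adj_low xy xn yn; have [|py pr] := IH y yp; first by rewrite /= yn.
split; first by rewrite axy.
by move=> v; rewrite inE => /orP[/eqP ->//|/pr].
Qed.

(** The vertex before the suffix is at least [n], so it is [n + w] for the first suffix vertex [w],
    and the step between them comes from the original edge [rw]. Recording [n + w] serves to show
    that different paths have different suffixes. *)
Lemma low_suffixP x p :
  path (adj S) x p -> ~~ all (gtn n) (x :: p) -> last x p < n ->
  let q := low_suffix p in
  [/\ path (adj (to_rooted (I, S))) r q, last r q = last x p,
      {in q, forall v, (v < n) && (v != r)}, subseq q p
    & exists2 w, ohead q = Some w & n + w \in x :: p].
Proof.
elim: p x => [|y p IH] x /=; first by move=> _ /negP; rewrite andbT.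
case/andP=> xy yp; case: (boolP ((y < n) && all (gtn n) p)) => [low|nlow _].
  rewrite andbT => xn _; have [yn pn] := andP low.
  have nx : n <= x by rewrite leqNgt.
  have yx : adj S y x by rewrite adj_sym.
  have [xE yr ary] := adj_mixed yx yn nx.
  have [py pr] := path_low yp low.
  split=> /=.
  - by rewrite ary.
  - by [].
  - move=> v; rewrite inE => /orP[/eqP ->|vp]; first by rewrite yn.
    by rewrite pr // andbT; apply: (allP pn).
  - by rewrite eqxx.
  - by exists y; rewrite // xE mem_head.
move=> lp; have [p1 p2 p3 p4 [w wq wp]] := IH y yp nlow lp.
split=> //; first exact: subseq_trans p4 (subseq_cons _ _).
by exists w => //; rewrite inE wp orbT.
Qed.

Lemma to_rooted_paths k t : t < n ->
  has_openly_disjoint_paths S k (n + r) t ->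
  has_openly_disjoint_paths (to_rooted (I, S)) k r t.
Proof.
move=> tn [P [sP uP pP dP]].
have lP p : p \in P ->
    [/\ path (adj (to_rooted (I, S))) r (low_suffix p), last r (low_suffix p) = t,
        {in low_suffix p, forall v, (v < n) && (v != r)}, subseq (low_suffix p) p
      & exists2 w, ohead (low_suffix p) = Some w & n + w \in (n + r) :: p].
  move=> /pP[ep lp up]; rewrite -[t]lp; apply: low_suffixP => //=.
    by rewrite ltnNge leq_addr.
  by rewrite lp.
have head_mem (q : seq nat) w : ohead q = Some w -> w \in q.
  by case: q => //= v q [->]; rewrite mem_head.
exists [seq low_suffix p | p <- P]; split.
- by rewrite size_map.
(* Paths with equal suffixes would share [n + w], which is neither [n + r], as [w != r], nor [t], as
   [t < n]. *)
- rewrite map_inj_in_uniq // => p q pM qM pq; apply/eqP/negPn/negP => npq.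
  have [_ _ low _ [w hw wp]] := lP _ pM; have [_ _ _ _ [w' hw' wq]] := lP _ qM.
  have /andP[wn wr] := low _ (head_mem _ _ hw).
  move: hw'; rewrite -pq hw => -[ww']; rewrite -ww' in wq.
  by have [/eqP|] := dP _ _ pM qM npq _ wp wq; [rewrite eqn_add2l (negbTE wr)|lia].
- move=> _ /mapP[p pM ->]; have [ep lp low sub _] := lP _ pM; split=> //=.
  rewrite (subseq_uniq sub) ?andbT; last by have [_ _ /andP[]] := pP _ pM.
  by apply/negP => /low; rewrite eqxx andbF.
- move=> _ _ /mapP[p pM ->] /mapP[q qM ->] pq v; rewrite !inE.
  case/orP => [/eqP|vp]; first by left.
  case/orP => [/eqP|vq]; first by left.
  have npq : p != q by apply: contraNneq pq => ->.
  have [_ _ low subp _] := lP _ pM; have [_ _ _ subq _] := lP _ qM.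
  have /andP[vn _] := low _ vp.
  have [||vE|] := dP _ _ pM qM npq v; last by right.
  + by rewrite inE (mem_subseq subp) ?orbT.
  + by rewrite inE (mem_subseq subq) ?orbT.
  + by move: vn; rewrite vE; lia.
Qed.

End ToRooted.

Lemma to_rooted_feasible S :
  subset_feasible (reduce I) S -> rooted_feasible I (to_rooted (I, S)).
Proof.
move=> [[uS SE] hS]; split.
  split=> [|e]; last by rewrite mem_rev mem_filter => /andP[].
  by rewrite rev_uniq filter_uniq //; case: I_ok => -[[]].
move=> t tT; have tn := terminal_bound tT.
apply: (to_rooted_paths SE tn); apply: hS => /=.
- exact: mem_head.
- by rewrite inE tT orbT.
- by rewrite -/n -/r; lia.
Qed.

(** * From rooted solutions to solutions of the subset problem *)

Section ToSubset.

Variable S : solution.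
Hypothesis S_sub : {subset S <= E}.
Let S' := to_subset (I, S).

Lemma adj_clique x y :
  n <= x < n + n -> n <= y < n + n -> x != y -> adj S' x y.
Proof.
move=> xb yb xy; rewrite /adj !mem_cat !mem_clique /= -/n.
by case: (ltngtP x y) xy => // *; apply/orP; [left|right]; apply/orP; right; lia.
Qed.

Lemma adj_bound_rooted u v : adj S u v -> v < n.
Proof. by move=> /orP[] /S_sub /edge_bound /=; lia. Qed.

Lemma adj_to_subset u v : adj S u v -> u != r -> v != r -> adj S' u v.
Proof.
have aux x y : (x, y) \in S -> x != r -> y != r -> (x, y) \in S'.
  move=> xyS xr yr; have <- : f (x, y) = (x, y).
    by rewrite /f /split_edge /= (negbTE xr) (negbTE yr).
  by rewrite mem_to_subset // S_sub.
by case/orP=> h ur vr; rewrite /adj (aux _ _ h) ?orbT.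
Qed.

Lemma adj_to_subset_root u : adj S r u -> u != r -> adj S' (n + u) u.
Proof.
move=> ru ur; suff : (u, n + u) \in S' by rewrite /adj => ->; rewrite orbT.
case/orP: ru => uS.
  have <- : f (r, u) = (u, n + u) by rewrite /f /split_edge /= eqxx.
  by rewrite mem_to_subset // S_sub.
have <- : f (u, r) = (u, n + u) by rewrite /f /split_edge /= (negbTE ur) eqxx.
by rewrite mem_to_subset // S_sub.
Qed.

Lemma to_subset_path x p : path (adj S) x p -> r \notin x :: p ->
  path (adj S') x p /\ {in p, forall v, v < n}.
Proof.
elim: p x => //= y p IH x /andP[xy yp]; rewrite !inE !negb_or.
case/and3P=> rx ry rp; have [|p1 p2] := IH y yp.
  by rewrite inE negb_or ry.
split; first by rewrite adj_to_subset // eq_sym.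
by move=> v; rewrite inE => /orP[/eqP ->|/p2//]; apply: adj_bound_rooted xy.
Qed.

Lemma to_subset_paths k t : t != r ->
  has_openly_disjoint_paths S k r t ->
  has_openly_disjoint_paths S' k (n + r) t.
Proof.
move=> tr [P [sP uP pP dP]]; have rn := root_bound.
(* A path from [r] to [w] and on becomes one from [n + r] through [n + w] to [w] and on; [p] is
   nonempty since [t != r], so [head] is its true first vertex. *)
pose g p := n + head 0 p :: p.
have gP p : p \in P -> exists w q,
    [/\ p = w :: q, w != r, path (adj S') (n + r) (g p),
        {in p, forall v, v < n} & (w = t -> p = [:: t])].
  move=> /pP[]; case: p => [|w q] /=; first by move=> _ /eqP; rewrite eq_sym (negbTE tr).
  case/andP=> rw wq lq /andP[rp uq]; exists w, q.
  have wr : w != r by move: rp; rewrite inE negb_or eq_sym => /andP[].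
  have wn := adj_bound_rooted rw; have [pq low] := to_subset_path wq rp.
  split=> //.
  - rewrite /= pq adj_to_subset_root // adj_clique ?eqn_add2l 1?eq_sym //; lia.
  - by move=> v; rewrite inE => /orP[/eqP ->|/low].
  - move=> wt; case: q lq uq {wq rp pq low} => [|v q] /= lq; first by rewrite wt.
    case/andP => + _.
    by rewrite wt -lq mem_last.
exists [seq g p | p <- P]; split.
- by rewrite size_map.
- by rewrite map_inj_uniq // => p q [].
- move=> _ /mapP[p pM ->]; have [w [q [pE wr gp low _]]] := gP _ pM.
  have [_ lp up] := pP _ pM; split=> //.
    by rewrite /g pE /= in lp *.
  have hi x : n + x \notin p by apply/negP => /low; lia.
  rewrite /g /= !hi /= inE negb_or hi andbT eqn_add2l.
  by rewrite pE /= eq_sym wr /=; move: up; rewrite pE => /andP[].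
- move=> _ _ /mapP[p pM ->] /mapP[q qM ->] pq v.
  have npq : p != q by apply: contraNneq pq => ->.
  have [w [p' [pE wr _ lowp wt]]] := gP _ pM.
  have [w' [q' [qE _ _ lowq wt']]] := gP _ qM.
  rewrite /g pE qE /= -pE -qE !inE.
  case/or3P => [/eqP|/eqP ->|vp]; first by left.
    case/or3P => [/eqP|/eqP/addnI ww|/lowq]; [by left| |lia].
    (* A shared [n + w] makes [w] the first vertex of both original paths; this forces [w = t], so
       both are the single edge [rt]. *)
    have wp : w \in r :: p by rewrite pE !inE eqxx orbT.
    have wq : w \in r :: q by rewrite qE ww !inE eqxx orbT.
    have [/eqP|wt2] := dP _ _ pM qM npq _ wp wq; first by rewrite (negbTE wr).
    by move: npq; rewrite (wt wt2) (wt' (etrans (esym ww) wt2)) eqxx.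
  case/or3P => [/eqP|/eqP vE|vq]; first by left.
    by have := lowp _ vp; rewrite vE; lia.
  have [||vr|] := dP _ _ pM qM npq v; try by rewrite inE ?vp ?vq orbT.
    by have [_ _ /andP[]] := pP _ pM; rewrite -vr vp.
  by right.
Qed.

End ToSubset.

Lemma to_subset_feasible S :
  rooted_feasible I S -> subset_feasible (reduce I) (to_subset (I, S)).
Proof.
move=> [Sok hS]; have S'ok := to_subset_edge_subset Sok.
have [_ SE] := Sok; have [_ S'E] := S'ok; split=> //.
have rooted t : t \in rterminals I ->
    has_openly_disjoint_paths (to_subset (I, S)) (rconn I) (n + r) t.
  move=> tT; apply: to_subset_paths => //; first exact: terminal_neq_root.
  exact: hS.
move=> s t; rewrite !inE -/n -/r.
case/orP=> [/eqP ->|sT] /orP[/eqP ->|tT] st.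
- by rewrite eqxx in st.
- exact: rooted.
- by apply: paths_sym; apply: rooted.
(* Two old terminals are connected by way of the new root, whose neighbours form a clique not
   containing them. *)
have nonadj x : x \in rterminals I -> ~~ adj (to_subset (I, S)) x (n + r).
  move=> /terminal_bound xn; apply/negP => /(adj_new_root S'E).
  by rewrite leqNgt xn.
apply: (paths_via_simplicial (r := n + r)) => //.
- by have := terminal_bound sT; lia.
- by have := terminal_bound tT; lia.
- exact: nonadj.
- exact: nonadj.
- by move=> x y /(adj_new_root S'E) xb /(adj_new_root S'E) yb; apply: adj_clique.
- by apply: paths_sym; apply: rooted.
- by apply: paths_sym; apply: rooted.
Qed.

End Reduction.

(** * Transfer of optimal costs and approximation guarantees *)

Lemma is_opt_transfer (F1 F2 : solution -> Prop) (c1 c2 : solution -> rat) g h x :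
  (forall S, F1 S -> F2 (g S) /\ c2 (g S) = c1 S) ->
  (forall S, F2 S -> F1 (h S) /\ c1 (h S) = c2 S) ->
  is_opt F1 c1 x -> is_opt F2 c2 x.
Proof.
move=> gP hP [[S FS cS] minx]; split.
  by exists (g S); [apply: (gP _ FS).1 | rewrite (gP _ FS).2].
by move=> S' FS'; have [FhS <-] := hP _ FS'; apply: minx.
Qed.

Theorem theorem4 :
  exists (reduce : rooted_instance -> subset_instance)
         (to_subset to_rooted : rooted_instance * solution -> solution),
  [/\ polytime enc_rooted enc_subset root_nonterminal reduce,
      polytime (enc_pair enc_rooted enc_solution) enc_solution
        (fun x => root_nonterminal x.1 /\ rooted_feasible x.1 x.2) to_subset,
      polytime (enc_pair enc_rooted enc_solution) enc_solution
        (fun x => root_nonterminal x.1 /\ subset_feasible (reduce x.1) x.2) to_rooted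
    & forall I : rooted_instance, root_nonterminal I ->
      (* the output is an instance with the same k and terminal set T + r' *)
      (subset_valid (reduce I) /\
       sconn (reduce I) = rconn I /\
       exists r' : nat,
         [/\ r' < nverts (sgraph (reduce I)), r' \notin rterminals I
           & sterminals (reduce I) =i r' :: rterminals I]) /\
      (* feasible solutions are transformed with the same cost *)
      (forall S, rooted_feasible I S ->
         subset_feasible (reduce I) (to_subset (I, S)) /\
         subset_cost (reduce I) (to_subset (I, S)) = rooted_cost I S) /\
      (forall S, subset_feasible (reduce I) S ->
         rooted_feasible I (to_rooted (I, S)) /\
         rooted_cost I (to_rooted (I, S)) = subset_cost (reduce I) S) /\
      (* the optimal costs are equal *)
      (forall x : rat,
         is_opt (rooted_feasible I) (rooted_cost I) x <->
         is_opt (subset_feasible (reduce I)) (subset_cost (reduce I)) x) /\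
      (* approximations carry over *)
      (forall (R : realFieldType) (beta : R) (S : solution),
         is_approx (subset_feasible (reduce I)) (subset_cost (reduce I)) beta S ->
         is_approx (rooted_feasible I) (rooted_cost I) beta (to_rooted (I, S)))].
Proof.
exists reduce, to_subset, to_rooted; split.
- exact: computable_polytime computable_treduce treduce_enc.
- exact: computable_polytime computable_tto_subset tto_subset_enc.
- exact: computable_polytime computable_tto_rooted tto_rooted_enc.
move=> I I_ok.
have toS S : rooted_feasible I S -> subset_feasible (reduce I) (to_subset (I, S)) /\
    subset_cost (reduce I) (to_subset (I, S)) = rooted_cost I S.
  by move=> FS; split; [apply: to_subset_feasible | apply: to_subset_cost FS.1.2].
have toR S : subset_feasible (reduce I) S -> rooted_feasible I (to_rooted (I, S)) /\
    rooted_cost I (to_rooted (I, S)) = subset_cost (reduce I) S.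
  by move=> FS; split; [apply: to_rooted_feasible | apply: to_rooted_cost].
have optP x : is_opt (rooted_feasible I) (rooted_cost I) x <->
    is_opt (subset_feasible (reduce I)) (subset_cost (reduce I)) x.
  by split; [apply: is_opt_transfer toS toR | apply: is_opt_transfer toR toS].
split; last split; last split; last split=> //.
- split; first exact: reduce_valid.
  split=> //; exists (nverts (rgraph I) + rroot I); split=> //=.
    by rewrite ltn_add2l; apply: root_bound.
  by apply/negP => /(terminal_bound I_ok); lia.
- exact: toS.
- exact: toR.
- move=> R beta S [FS [x optx le]]; have [FR cR] := toR _ FS.
  by split=> //; exists x; [apply/optP | rewrite cR].
Qed.
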